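(* Let $R$ be a commutative ring with unity, $M$ a free $R$-module of finite rank $m$, $\mathcal I=f_1R+\cdots+f_\ell R$ a proper ideal of $R$ generated by $f_1,\dots,f_\ell\in R$, and $\bar R=R/\mathcal I$, $\bar M=M/\mathcal IM$. Let $1\le k\le m$, fix a sequence $\omega_1,\dots,\omega_k\in M$ and integers $1\le p,r,s\le m$ such that $p\ge r$ and $r+s=k+1$. Put $\Omega=\omega_1\wedge\cdots\wedge\omega_k$ and $\bar\Omega=\bar\omega_1\wedge\cdots\wedge\bar\omega_k\in\Lambda^k\bar M$. (i) Assume that $p-r\le\operatorname{depth} I(\bar\Omega)-2$. Then an element $\eta\in\Lambda^pM$ can be represented in the form (A) $\ \eta=\sum_{J\in\mathcal J(r,k)}\omega_J\wedge\gamma_J+\sum_i f_i\xi_i$ for some $\gamma_J\in\Lambda^{p-r}M$ and $\xi_i\in\Lambda^pM$, if and only if (B) for all $I\in\mathcal J(s,k)$, $\ \omega_I\wedge\eta=\sum_i f_i\beta_{I,i}$ for some $\beta_{I,i}\in\Lambda^{p+s}M$. (ii) Without assuming this depth inequality, for any $\eta\in\Lambda^pM$ satisfying (B) there exists $n>0$ such that for any $b$ of the form $b=a^n$, $a\in I(\Omega)$, we have (A') $\ b\eta=\sum_{J\in\mathcal J(r,k)}\omega_J\wedge\gamma_J+\sum_i f_i\xi_i$ for some $\gamma_J\in\Lambda^{p-r}M$ and $\xi_i\in\Lambda^pM$. Conversely, if (A') holds for some $b\in R$ such that its equivalence class $\bar b$ is a non-zero-divisor in $\bar R$, then (B) holds,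 too. (iii) The elements $\gamma_J$ in the formula (A) are unique, modulo $\sum_i f_i\Lambda^{p-r}M$, when treated as skew-symmetric $(p-r)$-linear forms on $M^*$ restricted to $K=\bigcap_i\ker\omega_i\subset M^*$. (iv) More generally, if $b$ in the representation (A') is an arbitrary element of $R$ such that the equivalence class $\bar b$ is a non-zero-divisor in $\bar R$, then the elements $\bar\gamma_J/\bar b$ are uniquely determined by $\eta$ (independently of $b$) when treated as skew-symmetric $(p-r)$-linear forms on $\bar M_{fr}^*$ restricted to $\bar K_{fr}:=\bigcap_i\ker\bar\omega_i\subset\bar M_{fr}^*$, where $\bar\omega_i\in\bar M\subset\bar M_{fr}$ are treated as elements of $\bar M_{fr}$.
   Context: $\Lambda^qM$ is the $q$th exterior power of $M$ ($\Lambda^0M=R$, $\Lambda^qM=0$ for $q<0$ or $q>m$). $M^*=\operatorname{Hom}_R(M,R)$ is the dual module; elements of $\Lambda^qM$ are treated as skew-symmetric $q$-linear forms on $M^*$; for $\omega_i\in M$, $\ker\omega_i=\{g\in M^*:g(\omega_i)=0\}$. $\mathcal J(r,k)$ is the set of strictly increasing multiindices $J=(j_1,\dots,j_r)$, $1\le j_1<\cdots<j_r\le k$, and $\omega_J=\omega_{j_1}\wedge\cdots\wedge\omega_{j_r}$. A bar denotes the class in $\bar R$, $\bar M$ (a free $\bar R$-module of rank $m$), or $\Lambda^q\bar M\simeq\Lambda^qM/\mathcal I\Lambda^qM$. $I(\Omega)\subset R$ (resp. $I(\bar\Omega)\subset\bar R$) is the ideal generated by the coefficients of $\Omega$ (resp.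 $\bar\Omega$) in the basis of $\Lambda^kM$ (resp. $\Lambda^k\bar M$) induced by a basis of $M$. $\bar S$ is the multiplicative set of non-zero-divisors of $\bar R$, $\bar R_{fr}=\bar S^{-1}\bar R$ is the total ring of fractions, $\bar M_{fr}=\bar S^{-1}\bar M$ is the localization of $\bar M$, and $\bar M_{fr}^*$ is its dual module over $\bar R_{fr}$; $\bar M\subset\bar M_{fr}$ canonically, and in (iv) $\ker\bar\omega_i=\{g\in\bar M_{fr}^*: g(\bar\omega_i)=0\}$. The elements $\bar\gamma_J/\bar b$ lie in $\Lambda^{p-r}\bar M_{fr}$. For a commutative ring $A$, a sequence $a_1,\dots,a_q$ in $A$ is regular if $(a_1,\dots,a_q)\ne A$ and $a_i$ is a non-zero-divisor on $A/(a_1,\dots,a_{i-1})$ for all $i$. For a proper ideal $I$ of $A$, $\operatorname{depth} I$ is the supremum of lengths of regular sequences contained in $I$; $\operatorname{depth} A=\infty$.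
   Formalization: (iii) is stated under the depth inequality of (i), and (iv) under depth I(Ω̄) ≥ 1; without such a condition uniqueness fails, e.g. R a field, I = 0, k = r = s = p = 1, ω₁ = 0, η = 0, b = 1, where every γ is admissible. *)

(* Defs.v *)
From HB Require Import structures.
From mathcomp Require Import boolp classical_sets constructive_ereal.
From mathcomp Require Import all_boot all_order all_algebra.
From mathcomp Require Import generic_quotient ring_quotient ring.

Set Implicit Arguments.
Unset Strict Implicit.
Unset Printing Implicit Defensive.

Import Order.TTheory GRing.Theory Num.Theory.

Local Open Scope ring_scope.
Local Open Scope quotient_scope.

Definition ideal_span (A : comNzRingType) (T : finType) (a : T -> A) : set A :=
  [set x | exists c : T -> A, x = \sum_i c i * a i]%classic.

Definition seq_ideal (A : comNzRingType) (s : seq A) : set A :=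
  ideal_span (fun i : 'I_(size s) => s`_i).

Definition regular_seq (A : comNzRingType) (s : seq A) : Prop :=
  seq_ideal s <> [set: A]%classic /\
  forall i, (i < size s)%N -> forall x,
    seq_ideal (take i s) (s`_i * x) -> seq_ideal (take i s) x.

(* The supremum is taken in the extended integers, so it is +oo when regular
   sequences of arbitrary length exist. *)
Definition depth (A : comNzRingType) (I : set A) : \bar int :=
  if `[< I = [set: A]%classic >] then +oo%E
  else supremum -oo%E
    [set n : \bar int | exists s : seq A,
      [/\ regular_seq s, forall x, x \in s -> I x & n = ((size s)%:Z)%:E]]%classic.

(* The non-zero-divisors s of A are the elements such that [GRing.lreg s]. *)
Section TotalFractions.
Variable A : comNzRingType.

Record ratio := MkRatio {
  ratio_val :> A * A;
  _ : `[< GRing.lreg ratio_val.2 >]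
}.
HB.instance Definition _ := [isSub for ratio_val].
HB.instance Definition _ := [Choice of ratio by <:].

Lemma den_reg (x : ratio) : GRing.lreg x.2.
Proof. by case: x => x /= /asboolP. Qed.
Arguments den_reg : clear implicits.

Lemma lreg1_asbool : `[< GRing.lreg (1 : A) >].
Proof. by apply/asboolP; apply: lreg1. Qed.

Definition mkratio (a s : A) : ratio :=
  insubd (MkRatio (ratio_val := (0, 1)) lreg1_asbool) (a, s).

Lemma mkratioE a s : GRing.lreg s -> ratio_val (mkratio a s) = (a, s).
Proof. by move=> h; rewrite /mkratio val_insubd /= asboolT. Qed.

Lemma ratio_numden (x : ratio) : mkratio x.1 x.2 = x.
Proof.
by apply: val_inj; rewrite /= mkratioE; [case: x => [[]] | apply: den_reg].
Qed.

Definition ratio_eq (x y : ratio) := x.1 * y.2 == y.1 * x.2.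

Fact ratio_eq_refl : reflexive ratio_eq. Proof. by move=> x; apply: eqxx. Qed.
Fact ratio_eq_sym : symmetric ratio_eq. Proof. by move=> x y; apply: eq_sym. Qed.
Fact ratio_eq_trans : transitive ratio_eq.
Proof.
move=> y x z /eqP xy /eqP yz; apply/eqP/(den_reg y).
transitivity (x.1 * y.2 * z.2); first by ring.
by rewrite xy; transitivity (y.1 * z.2 * x.2); [ring | rewrite yz; ring].
Qed.

Canonical ratio_eq_equiv :=
  EquivRel ratio_eq ratio_eq_refl ratio_eq_sym ratio_eq_trans.

Definition totfrac := {eq_quot ratio_eq}.
HB.instance Definition _ : EqQuotient _ ratio_eq totfrac := EqQuotient.on totfrac.
HB.instance Definition _ := Choice.on totfrac.

(* a / s; the junk value 0 when s is a zero divisor *)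
Definition tfrac (a s : A) : totfrac := \pi_totfrac (mkratio a s).

Lemma tfrac_eq a s b t : GRing.lreg s -> GRing.lreg t ->
  (tfrac a s = tfrac b t) <-> (a * t = b * s).
Proof.
move=> hs ht; rewrite /tfrac; split.
  by move=> /eqmodP /eqP; rewrite !mkratioE.
by move=> e; apply/eqmodP/eqP; rewrite !mkratioE.
Qed.

Lemma tfracP (x : totfrac) : exists a s, GRing.lreg s /\ x = tfrac a s.
Proof.
elim/quotW: x => x; exists x.1, x.2; split; first exact: den_reg.
by rewrite /tfrac ratio_numden.
Qed.

Definition tf_add (x y : totfrac) :=
  tfrac ((repr x).1 * (repr y).2 + (repr y).1 * (repr x).2)
        ((repr x).2 * (repr y).2).
Definition tf_mul (x y : totfrac) :=
  tfrac ((repr x).1 * (repr y).1) ((repr x).2 * (repr y).2).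
Definition tf_opp (x : totfrac) := tfrac (- (repr x).1) (repr x).2.

Lemma repr_tfrac a s : GRing.lreg s ->
  (repr (tfrac a s)).1 * s = a * (repr (tfrac a s)).2.
Proof.
move=> hs; apply: (proj1 (tfrac_eq _ _ (den_reg (repr (tfrac a s))) hs)).
by rewrite {1}/tfrac ratio_numden reprK.
Qed.

Lemma tf_addE a s b t : GRing.lreg s -> GRing.lreg t ->
  tf_add (tfrac a s) (tfrac b t) = tfrac (a * t + b * s) (s * t).
Proof.
move=> hs ht; apply: (proj2 (tfrac_eq _ _ _ _));
  try exact: lregM (den_reg _) (den_reg _).
  exact: lregM.
have := repr_tfrac a hs; have := repr_tfrac b ht.
move: (repr (tfrac a s)) (repr (tfrac b t)) => x y ey ex.
transitivity (x.1 * s * (y.2 * t) + y.1 * t * (x.2 * s)); first by ring.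
by rewrite ex ey; ring.
Qed.

Lemma tf_mulE a s b t : GRing.lreg s -> GRing.lreg t ->
  tf_mul (tfrac a s) (tfrac b t) = tfrac (a * b) (s * t).
Proof.
move=> hs ht; apply: (proj2 (tfrac_eq _ _ _ _));
  try exact: lregM (den_reg _) (den_reg _).
  exact: lregM.
have := repr_tfrac a hs; have := repr_tfrac b ht.
move: (repr (tfrac a s)) (repr (tfrac b t)) => x y ey ex.
by transitivity (x.1 * s * (y.1 * t)); [ring | rewrite ex ey; ring].
Qed.

Lemma tf_oppE a s : GRing.lreg s -> tf_opp (tfrac a s) = tfrac (- a) s.
Proof.
move=> hs; apply: (proj2 (tfrac_eq _ _ _ _)); [exact: den_reg | exact: hs |].
by rewrite mulNr repr_tfrac // mulNr.
Qed.

Ltac tf_elim x := have [? [? [? ->]]] := tfracP x.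
Ltac tf_reg :=
  repeat first [assumption | simple apply lreg1 | simple apply lregM].
Ltac tf_solve :=
  do ?[rewrite tf_addE; [|by tf_reg..] | rewrite tf_mulE; [|by tf_reg..]
      | rewrite tf_oppE; [|by tf_reg..]];
  apply: (proj2 (tfrac_eq _ _ _ _)); [by tf_reg..|ring].

Fact tf_addA : associative tf_add.
Proof. by move=> x y z; tf_elim x; tf_elim y; tf_elim z; tf_solve. Qed.
Fact tf_addC : commutative tf_add.
Proof. by move=> x y; tf_elim x; tf_elim y; tf_solve. Qed.
Fact tf_add0 : left_id (tfrac 0 1) tf_add.
Proof. by move=> x; tf_elim x; tf_solve. Qed.
Fact tf_addN : left_inverse (tfrac 0 1) tf_opp tf_add.
Proof. by move=> x; tf_elim x; tf_solve. Qed.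
HB.instance Definition _ :=
  GRing.isZmodule.Build totfrac tf_addA tf_addC tf_add0 tf_addN.

Fact tf_mulA : associative tf_mul.
Proof. by move=> x y z; tf_elim x; tf_elim y; tf_elim z; tf_solve. Qed.
Fact tf_mulC : commutative tf_mul.
Proof. by move=> x y; tf_elim x; tf_elim y; tf_solve. Qed.
Fact tf_mul1 : left_id (tfrac 1 1) tf_mul.
Proof. by move=> x; tf_elim x; tf_solve. Qed.
Fact tf_mulDl : left_distributive tf_mul tf_add.
Proof. by move=> x y z; tf_elim x; tf_elim y; tf_elim z; tf_solve. Qed.
Fact tf_1neq0 : tfrac 1 1 != 0.
Proof.
apply/eqP => /(proj1 (tfrac_eq _ _ (@lreg1 _) (@lreg1 _))) /eqP.
by rewrite !mulr1 oner_eq0.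
Qed.
HB.instance Definition _ :=
  GRing.Zmodule_isComNzRing.Build totfrac tf_mulA tf_mulC tf_mul1 tf_mulDl tf_1neq0.

Definition tofrac (a : A) : totfrac := tfrac a 1.
Fact tofrac_is_zmod_morphism : zmod_morphism tofrac.
Proof.
by move=> a b; symmetry; rewrite /tofrac -[LHS]/(tf_add _ (tf_opp _)); tf_solve.
Qed.
Fact tofrac_is_monoid_morphism : monoid_morphism tofrac.
Proof. by split=> // a b; symmetry; rewrite /tofrac -[LHS]/(tf_mul _ _); tf_solve. Qed.
HB.instance Definition _ :=
  GRing.isZmodMorphism.Build A totfrac tofrac tofrac_is_zmod_morphism.
HB.instance Definition _ :=
  GRing.isMonoidMorphism.Build A totfrac tofrac tofrac_is_monoid_morphism.

End TotalFractions.

(* A free module of rank m with a chosen basis. This is used instead of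
   [vectType] because the coordinates [v2r] of the latter are opaque, so that
   those of a module and of its extensions of scalars could not be related. *)
Record freeModule (R : comNzRingType) (m : nat) := FreeModule {
  free_sort :> lmodType R;
  basis : 'I_m -> free_sort;
  coords : free_sort -> 'rV[R]_m;
  coords_sum : forall x : free_sort, \sum_i coords x 0 i *: basis i = x;
  sum_coords : forall c : 'rV[R]_m, coords (\sum_i c 0 i *: basis i) = c }.

Fact row_basisE (A : comNzRingType) (m : nat) (c : 'rV[A]_m) :
  \sum_i c 0 i *: delta_mx 0 i = c.
Proof. by rewrite [RHS]row_sum_delta. Qed.

(* Extension of scalars A (x)_R M, in coordinates: this is M / IM when A = R / I,
   and the localization of M when A is the total ring of fractions of R. *)
Definition bchange (R A : comNzRingType) (phi : {rmorphism R -> A}) (m : nat)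
    (M : freeModule R m) : freeModule A m :=
  FreeModule (free_sort := 'rV[A]_m) (coords := id)
    (@row_basisE A m) (@row_basisE A m).

Definition to_bchange (R A : comNzRingType) (phi : {rmorphism R -> A}) (m : nat)
    (M : freeModule R m) (x : M) : bchange phi M :=
  map_mx phi (coords x).

(* Exterior algebra of a free module M of finite rank: an element is given by
   its coefficients in the basis (e_S) of monomials, where e_S is the wedge
   product of the basis vectors of M with indices in S, in increasing order. *)

Definition ext (R : comNzRingType) (m : nat) (M : freeModule R m) : Type :=
  {ffun {set 'I_m} -> R^o}.

Definition increasing (n q : nat) (t : q.-tuple 'I_n) : bool :=
  sorted ltn (map val t).

Section Exterior.
Variables (R : comNzRingType) (m : nat) (M : freeModule R m).
Implicit Types (S T U : {set 'I_m}) (u v w : ext M).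

HB.instance Definition _ := GRing.Lmodule.copy (ext M) {ffun {set 'I_m} -> R^o}.

Definition coef u S : R := fun_of_fin u S.

Lemma extP u v : (forall S, coef u S = coef v S) -> u = v.
Proof. by move=> h; apply/ffunP. Qed.

Definition mkext (F : {set 'I_m} -> R) : ext M := [ffun S => F S].

Lemma coefE F S : coef (mkext F) S = F S. Proof. by rewrite /coef ffunE. Qed.

Definition extpow (q : nat) : {pred ext M} :=
  fun u => [forall S : {set 'I_m}, (coef u S != 0) ==> (#|S| == q)].

Definition inversions S T : nat := \sum_(i in S) \sum_(j in T) (j < i)%N.

Definition wedge u v : ext M :=
  mkext (fun U => \sum_(S in powerset U)
    (-1) ^+ inversions S (U :\: S) * coef u S * coef v (U :\: S)).

Definition emon T : ext M := mkext (fun S => (S == T)%:R).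
Definition ext1 := emon set0.

Definition ext_vec (x : M) : ext M := \sum_i coords x 0 i *: emon [set i].

(* u in the q-th exterior power, as a q-linear form on the dual of M:
   x_1 /\ ... /\ x_q is the form (g_1, ..., g_q) |-> det (g_i x_j). *)
Definition ext_form (q : nat) u (g : 'I_q -> {linear M -> R^o}) : R :=
  \sum_(t : q.-tuple 'I_m | increasing t)
    coef u [set i in t] * \det (\matrix_(i, j) (g i (basis M (tnth t j)) : R)).

(* When u is in the q-th exterior power, only its coefficients of degree q
   can be nonzero. *)
Definition coef_ideal u : set R := ideal_span (coef u).

End Exterior.

Notation "''Lambda^' q ( M )" := (@extpow _ _ M q)
  (at level 8, q at level 2, format "''Lambda^' q ( M )").

Section ExteriorTheory.
Variables (R : comNzRingType) (m : nat) (M : freeModule R m).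
Implicit Types (S T U : {set 'I_m}) (u v w : ext M).

Lemma inversionsUl S T U : [disjoint S & T] ->
  inversions (S :|: T) U = (inversions S U + inversions T U)%N.
Proof.
by move=> d; rewrite /inversions -bigU //; apply: eq_bigl => i; rewrite !inE.
Qed.

Lemma inversionsUr S T U : [disjoint T & U] ->
  inversions S (T :|: U) = (inversions S T + inversions S U)%N.
Proof.
move=> d; rewrite /inversions -big_split /=.
by apply: eq_bigr => i _; rewrite -bigU //; apply: eq_bigl => j; rewrite !inE.
Qed.

Lemma wedgeA : associative (@wedge R m M).
Proof.
move=> u v w; apply: extP => U; rewrite !coefE.
transitivity (\sum_(S in powerset U) \sum_(T in powerset (U :\: S))
    (-1) ^+ (inversions S T + inversions S ((U :\: S) :\: T)
             + inversions T ((U :\: S) :\: T))%N *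
    (coef u S * coef v T * coef w ((U :\: S) :\: T))).
  apply: eq_bigr => S _; rewrite coefE mulr_sumr; apply: eq_bigr => T.
  rewrite powersetE => sT.
  have -> : inversions S (U :\: S) =
      (inversions S T + inversions S ((U :\: S) :\: T))%N.
    rewrite -inversionsUr; last by rewrite disjoints_subset setCD subsetUr.
    by rewrite -{1}(setIidPr sT) setID.
  by rewrite !exprD (AC (3*3) ((1*2*4)*(3*5*6))).
transitivity (\sum_(V in powerset U) \sum_(S in powerset V)
    (-1) ^+ (inversions S (V :\: S) + inversions S (U :\: V)
             + inversions (V :\: S) (U :\: V))%N *
    (coef u S * coef v (V :\: S) * coef w (U :\: V))); last first.
  apply: eq_bigr => V _; rewrite coefE mulr_sumr mulr_suml.
  apply: eq_bigr => S; rewrite powersetE => sS.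
  have -> : inversions V (U :\: V) =
      (inversions S (U :\: V) + inversions (V :\: S) (U :\: V))%N.
    rewrite -inversionsUl; last by rewrite disjoints_subset setCD subsetUr.
    by rewrite -{1}(setIidPr sS) setID.
  by rewrite !exprD (AC ((2*3)*1) ((3*1*2)*(4*5*6))).
rewrite [RHS](exchange_big_dep (fun S => S \in powerset U)) /=; last first.
  by move=> V S; rewrite !powersetE => sV sS; apply: subset_trans sS sV.
apply: eq_bigr => S; rewrite powersetE => sS.
rewrite [RHS](reindex_onto (fun T => S :|: T) (fun V => V :\: S)) /=; last first.
  move=> V /andP[_]; rewrite powersetE => sV.
  by rewrite setUC setDE setUIl [~: S :|: S]setUC setUCr setIT;
     apply/setUidPl.
apply: eq_big => T.
  rewrite !powersetE subsetUl andbT subUset sS /= subsetD setDUl setDv set0U.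
  by rewrite eqEsubset subsetDl subsetD subxx.
rewrite powersetE subsetD => /andP[sT d].
have -> : (S :|: T) :\: S = T.
  by rewrite setDUl setDv set0U; apply/setDidPl.
by rewrite setDDl.
Qed.

Lemma inversions0l S : inversions set0 S = 0%N.
Proof. by rewrite /inversions big_set0. Qed.
Lemma inversions0r S : inversions S set0 = 0%N.
Proof. by rewrite /inversions big1 // => i _; rewrite big_set0. Qed.

Lemma wedge1x : left_id (ext1 M) (@wedge R m M).
Proof.
move=> u; apply: extP => U; rewrite coefE (bigD1 set0) ?powersetE ?sub0set //=.
rewrite coefE eqxx inversions0l setD0 !mul1r big1 ?addr0 // => S /andP[_ /negPf nS].
by rewrite coefE nS mulr0 mul0r.
Qed.

Lemma wedgex1 : right_id (ext1 M) (@wedge R m M).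
Proof.
move=> u; apply: extP => U; rewrite coefE (bigD1 U) ?powersetE //=.
rewrite coefE setDv eqxx inversions0r mul1r mulr1 big1 ?addr0 // => S.
rewrite powersetE => /andP[sS nS]; rewrite coefE; case: eqP => [e|]; last by rewrite mulr0.
by case/eqP: nS; apply/eqP; rewrite eqEsubset sS -setD_eq0 e eqxx.
Qed.

HB.instance Definition _ :=
  Monoid.isLaw.Build (ext M) (ext1 M) (@wedge R m M) wedgeA wedge1x wedgex1.

End ExteriorTheory.

Lemma wedge_emon (R : comNzRingType) (m : nat) (M : freeModule R m)
    (S T : {set 'I_m}) :
  wedge (emon M S) (emon M T) =
    if [disjoint S & T] then (-1) ^+ inversions S T *: emon M (S :|: T) else 0.
Proof.
apply: extP => U; rewrite coefE.
have -> : coef (if [disjoint S & T] then (-1) ^+ inversions S T *: emon M (S :|: T) else 0) U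
    = if [disjoint S & T] && (U == S :|: T) then (-1) ^+ inversions S T else 0.
  case: ifP => d /=; last by rewrite /coef ffunE.
  rewrite /coef /GRing.scale /= ffunE ffunE /GRing.scale /=.
  by case: eqP; rewrite (mulr1, mulr0).
have [dU|dU] := boolP ([disjoint S & T] && (U == S :|: T)).
  have [dST /eqP ->] := andP dU.
  have e : (S :|: T) :\: S = T.
    by rewrite setDUl setDv set0U; apply/setDidPl; rewrite disjoint_sym.
  rewrite (bigD1 S) ?powersetE ?subsetUl //= !coefE e !eqxx !mulr1 big1 ?addr0 //.
  by move=> S' /andP[_ /negPf nS]; rewrite !coefE nS mulr0 mul0r.
rewrite big1 // => S'; rewrite powersetE => sS; rewrite !coefE.
case: eqP => [eS|]; last by rewrite mulr0 mul0r.
case: eqP => [eT|]; last by rewrite mulr0.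
case/negP: dU; rewrite -eS -eT; apply/andP; split.
  by rewrite disjoint_sym disjoints_subset setDE subsetIr.
by rewrite -{1}(setIidPr sS) setID.
Qed.

(* For a ring morphism phi : R -> A, the induced map from the exterior algebra
   of M to that of the extension of scalars of M, coefficient by coefficient. *)
Definition ext_bchange (R A : comNzRingType) (phi : {rmorphism R -> A})
    (m : nat) (M : freeModule R m) (u : ext M) : ext (bchange phi M) :=
  mkext (bchange phi M) (fun S => phi (coef u S)).

Definition quot_map (R : comNzRingType) (I : idealr R) :
  {rmorphism R -> {ideal_quot I}} := \pi_({ideal_quot I}).

Definition frac_map (A : comNzRingType) : {rmorphism A -> totfrac A} := @tofrac A.

Definition ext_frac (A : comNzRingType) (m : nat) (M : freeModule A m)
    (u : ext M) (b : A) : ext (bchange (frac_map A) M) :=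
  mkext (bchange (frac_map A) M) (fun S => tfrac (coef u S) b).

Section Division.
Variables (R : comNzRingType) (m : nat) (M : freeModule R m) (l k : nat).
Variables (f : 'I_l -> R) (omega : 'I_k -> M).

Definition wedge_seq (J : seq 'I_k) : ext M :=
  \big[@wedge R m M / ext1 M]_(j <- J) ext_vec (omega j).

Definition wedge_all : ext M :=
  \big[@wedge R m M / ext1 M]_(j < k) ext_vec (omega j).

Definition in_kernels (q : nat) (g : 'I_q -> {linear M -> R^o}) : Prop :=
  forall i j, g i (omega j) = 0.

Definition division (p r : nat) (eta : ext M) (gamma : r.-tuple 'I_k -> ext M) : Prop :=
  (forall J, increasing J -> gamma J \in 'Lambda^(p - r)(M)) /\
  exists xi : 'I_l -> ext M, (forall i, xi i \in 'Lambda^p(M)) /\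
    eta = \sum_(J : r.-tuple 'I_k | increasing J) wedge (wedge_seq J) (gamma J)
          + \sum_i f i *: xi i.

Definition wedge_vanish (p s : nat) (eta : ext M) : Prop :=
  forall J : s.-tuple 'I_k, increasing J ->
  exists beta : 'I_l -> ext M, (forall i, beta i \in 'Lambda^(p + s)(M)) /\
    wedge (wedge_seq J) eta = \sum_i f i *: beta i.

End Division.

(* Main.v *)
Require Import Defs.
From HB Require Import structures.
From mathcomp Require Import boolp classical_sets constructive_ereal.
From mathcomp Require Import all_boot all_order all_algebra.
From mathcomp Require Import generic_quotient ring_quotient ring zify.

(* Everything is done modulo an ideal [P] of [R], given as a predicate, so that
   no quotient ring is needed for the divisions.

   For a coefficient [a] of Omega, replacing [omega j] by [x] in Omega gives a
   covector sending [omega j] to [a] and the other forms to 0; the resulting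
   homotopies [a = omega j /\ c + c (omega j /\ _)] show that [a ^+ k * eta] is
   divisible whenever all [omega_I /\ eta] vanish, [I] of size [s]. This gives
   (ii). For (i), let [b eta = \sum_J omega_J /\ gamma_J], where [b] is a power of
   the first term of a regular sequence. Modulo [b], Omega annihilates each
   [gamma_J], so by induction on the length of the sequence
   [gamma_J = b gamma'_J] modulo the [omega j]. Then
   [b (eta - \sum_J omega_J /\ gamma'_J)] is a combination of products of [r.+1]
   forms, and the same induction applies with [r.+1] and [s.-1].

   For uniqueness, the difference [d] of two quotients satisfies
   [Omega /\ d = 0], and contracting this with covectors [g i] which kill the
   forms gives [d(g) Omega = 0]; when the depth is large enough, (i) even writes
   [d] as a combination of the [omega j]. *)

Set Implicit Arguments.
Unset Strict Implicit.
Unset Printing Implicit Defensive.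

Import GRing.Theory.

Local Open Scope ring_scope.

(** * Bilinearity, grading and contraction in the exterior algebra *)

Section ExteriorAlgebra.
Variables (R : comNzRingType) (m : nat) (M : freeModule R m).
Implicit Types (S T U : {set 'I_m}) (u v w : ext M) (a : R) (c d : 'I_m -> R).

Lemma coef_wedge u v U : coef (wedge u v) U = \sum_(S in powerset U)
  (-1) ^+ inversions S (U :\: S) * coef u S * coef v (U :\: S).
Proof. exact: Defs.coefE. Qed.

Lemma coef_emon T S : coef (emon M T) S = (S == T)%:R.
Proof. exact: Defs.coefE. Qed.

Lemma coef_ext0 S : coef (0 : ext M) S = 0.
Proof. by rewrite /coef ffunE. Qed.

Lemma coef_extD u v S : coef (u + v) S = coef u S + coef v S.
Proof. by rewrite /coef ffunE. Qed.

Lemma coef_extZ a u S : coef (a *: u) S = a * coef u S.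
Proof. by rewrite /coef ffunE. Qed.

Lemma coef_extN u S : coef (- u) S = - coef u S.
Proof. by rewrite -scaleN1r coef_extZ mulN1r. Qed.

Lemma coef_extB u v S : coef (u - v) S = coef u S - coef v S.
Proof. by rewrite coef_extD coef_extN. Qed.

Lemma coef_ext_sum (J : Type) (s : seq J) (P : pred J) (F : J -> ext M) S :
  coef (\sum_(i <- s | P i) F i) S = \sum_(i <- s | P i) coef (F i) S.
Proof. by elim/big_rec2: _ => [|i x u _ <-]; rewrite ?coef_ext0 ?coef_extD. Qed.

Lemma wedgeDl u v w : wedge (u + v) w = wedge u w + wedge v w.
Proof.
apply: extP => U; rewrite coef_extD !coef_wedge -big_split; apply: eq_bigr => S _.
by rewrite coef_extD mulrDr mulrDl.
Qed.

Lemma wedgeDr u v w : wedge u (v + w) = wedge u v + wedge u w.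
Proof.
apply: extP => U; rewrite coef_extD !coef_wedge -big_split; apply: eq_bigr => S _.
by rewrite coef_extD mulrDr.
Qed.

Lemma wedgeZl a u v : wedge (a *: u) v = a *: wedge u v.
Proof.
apply: extP => U; rewrite coef_extZ !coef_wedge mulr_sumr; apply: eq_bigr => S _.
by rewrite coef_extZ; ring.
Qed.

Lemma wedgeZr a u v : wedge u (a *: v) = a *: wedge u v.
Proof.
apply: extP => U; rewrite coef_extZ !coef_wedge mulr_sumr; apply: eq_bigr => S _.
by rewrite coef_extZ; ring.
Qed.

Lemma wedge0l u : wedge 0 u = 0.
Proof. by rewrite -(scale0r (0 : ext M)) wedgeZl !scale0r. Qed.

Lemma wedge0r u : wedge u 0 = 0.
Proof. by rewrite -(scale0r (0 : ext M)) wedgeZr !scale0r. Qed.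

Lemma wedgeNr u v : wedge u (- v) = - wedge u v.
Proof. by rewrite -!scaleN1r wedgeZr. Qed.

Lemma wedgeBr u v w : wedge u (v - w) = wedge u v - wedge u w.
Proof. by rewrite wedgeDr wedgeNr. Qed.

Lemma wedge_suml (J : Type) (s : seq J) (P : pred J) (F : J -> ext M) u :
  wedge (\sum_(i <- s | P i) F i) u = \sum_(i <- s | P i) wedge (F i) u.
Proof. exact: (big_morph (@wedge R m M ^~ u) (fun v w => wedgeDl v w u) (wedge0l u)). Qed.

Lemma wedge_sumr (J : Type) (s : seq J) (P : pred J) (F : J -> ext M) u :
  wedge u (\sum_(i <- s | P i) F i) = \sum_(i <- s | P i) wedge u (F i).
Proof. exact: (big_morph (wedge u) (wedgeDr u) (wedge0r u)). Qed.

Lemma inversions1l i T : inversions [set i] T = (\sum_(j in T) (j < i))%N.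
Proof. by rewrite /inversions big_set1. Qed.

Lemma inversions11 (i j : 'I_m) : inversions [set i] [set j] = (j < i)%N.
Proof. by rewrite inversions1l big_set1. Qed.

Definition ext_lin c : ext M := \sum_i c i *: emon M [set i].

Lemma wedge_emon1_anti (i j : 'I_m) :
  wedge (emon M [set i]) (emon M [set j])
  = - wedge (emon M [set j]) (emon M [set i]).
Proof.
rewrite !wedge_emon !inversions11 !disjoints1 !inE [j == i]eq_sym.
case: eqVneq => [_|neq] /=; first by rewrite oppr0.
rewrite [[set j] :|: _]setUC; case: ltngtP => [_|_|/val_inj e] /=.
- by rewrite expr0 expr1 scaleN1r scale1r.
- by rewrite expr0 expr1 scaleN1r scale1r opprK.
by rewrite e eqxx in neq.
Qed.

Lemma ext_lin_anti c d :
  wedge (ext_lin c) (ext_lin d) = - wedge (ext_lin d) (ext_lin c).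
Proof.
rewrite /ext_lin !wedge_suml -sumrN.
under eq_bigr do rewrite wedge_sumr.
under [RHS]eq_bigr do rewrite wedge_sumr -sumrN.
rewrite exchange_big /=; apply: eq_bigr => i _; apply: eq_bigr => j _.
by rewrite !wedgeZl !wedgeZr wedge_emon1_anti !scalerN !scalerA mulrC.
Qed.

(** Anticommutativity only shows that twice the square is zero. So the double sum is split: its
    diagonal vanishes, and the terms [(i, j)] and [(j, i)] cancel. *)
Lemma ext_lin_sq c : wedge (ext_lin c) (ext_lin c) = 0.
Proof.
rewrite /ext_lin wedge_suml.
under eq_bigr do rewrite wedge_sumr.
pose F i j := wedge (c i *: emon M [set i]) (c j *: emon M [set j]).
rewrite -[LHS]/(\sum_i \sum_j F i j).
have F0 i : F i i = 0.
  by rewrite /F wedgeZl wedgeZr wedge_emon disjoints1 !inE eqxx !scaler0.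
have FN i j : F i j = - F j i.
  by rewrite /F !wedgeZl !wedgeZr wedge_emon1_anti !scalerN !scalerA mulrC.
have split_F i : \sum_j F i j =
    \sum_(j : 'I_m | (i < j)%N) F i j + \sum_(j : 'I_m | (j < i)%N) F i j.
  rewrite (bigID (fun j : 'I_m => i < j)%N) /=; congr (_ + _).
  rewrite (bigID (fun j : 'I_m => j == i)) /= big_mkcond /= big1 => [|j _].
    by rewrite add0r; apply: eq_bigl => j; rewrite -leqNgt ltn_neqAle andbC.
  by case: ifP => // /andP[_ /eqP->]; exact: F0.
under eq_bigr do rewrite split_F.
rewrite big_split /= [X in _ + X](exchange_big_dep xpredT) //=.
rewrite -big_split big1 // => i _; rewrite -big_split big1 //= => j _.
by rewrite [F j i]FN subrr.
Qed.

(** Projection onto degree [q], used to make the witnesses of a division homogeneous once they have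
    been found. *)
Definition homog (q : nat) u : ext M :=
  mkext M (fun S => if #|S| == q then coef u S else 0).

Lemma coef_homog q u S : coef (homog q u) S = if #|S| == q then coef u S else 0.
Proof. exact: Defs.coefE. Qed.

Lemma extpowP q u :
  reflect (forall S, #|S| != q -> coef u S = 0) (u \in 'Lambda^q(M)).
Proof.
apply: (iffP forallP) => h S; first by move=> n; apply/eqP/negbNE/(contraNN _ n); apply/implyP/h.
by apply/implyP; apply: contraNT => /h ->.
Qed.

Lemma homog_in q u : homog q u \in 'Lambda^q(M).
Proof. by apply/extpowP => S /negPf n; rewrite coef_homog n. Qed.

Lemma homog_id q u : u \in 'Lambda^q(M) -> homog q u = u.
Proof.
by move/extpowP => h; apply: extP => S; rewrite coef_homog; case: eqVneq => // /h.
Qed.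

Lemma homog0 q : homog q 0 = 0.
Proof. by apply: extP => S; rewrite coef_homog coef_ext0 if_same. Qed.

Lemma homogD q u v : homog q (u + v) = homog q u + homog q v.
Proof.
by apply: extP => S; rewrite coef_extD !coef_homog coef_extD; case: ifP; rewrite ?addr0.
Qed.

Lemma extpow0 q : (0 : ext M) \in 'Lambda^q(M).
Proof. by apply/extpowP => S _; rewrite coef_ext0. Qed.

Lemma extpowZ q a u : u \in 'Lambda^q(M) -> a *: u \in 'Lambda^q(M).
Proof. by move=> /extpowP h; apply/extpowP => S /h e; rewrite coef_extZ e mulr0. Qed.

Lemma extpowD q u v :
  u \in 'Lambda^q(M) -> v \in 'Lambda^q(M) -> u + v \in 'Lambda^q(M).
Proof.
by move=> /extpowP h /extpowP h'; apply/extpowP => S n; rewrite coef_extD h ?h' ?addr0.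
Qed.

Lemma extpowB q u v :
  u \in 'Lambda^q(M) -> v \in 'Lambda^q(M) -> u - v \in 'Lambda^q(M).
Proof. by move=> hu hv; rewrite -scaleN1r extpowD ?extpowZ. Qed.

Lemma extpow_sum (J : Type) (s : seq J) (P : pred J) (F : J -> ext M) q :
  (forall i, P i -> F i \in 'Lambda^q(M)) -> \sum_(i <- s | P i) F i \in 'Lambda^q(M).
Proof. by move=> h; elim/big_ind: _ => //; [exact: extpow0 | exact: extpowD]. Qed.

(** Only subsets of size [p] contribute to the left factor, which leaves degree [q - p] for the
    right one, and nothing when [q < p]. *)
Lemma homog_wedge p q u v : u \in 'Lambda^p(M) ->
  homog q (wedge u v) = if (p <= q)%N then wedge u (homog (q - p) v) else 0.
Proof.
move=> /extpowP hu; apply: extP => U; rewrite coef_homog.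
transitivity (\sum_(S in powerset U | (#|S| == p) && (#|U| == q))
    (-1) ^+ inversions S (U :\: S) * coef u S * coef v (U :\: S)).
  case: eqP => _; last by rewrite big_pred0 // => S; rewrite !andbF.
  rewrite coef_wedge [LHS](bigID (fun S => #|S| == p)) /= [X in _ + X]big1 ?addr0.
    by apply: eq_bigl => S; rewrite andbT.
  by move=> S /andP[_ /hu ->]; rewrite mulr0 mul0r.
case: leqP => pq; last first.
  rewrite coef_ext0 big1 // => S; rewrite powersetE => /and3P[/subset_leq_card sS /eqP e /eqP e'].
  by rewrite e e' leqNgt pq in sS.
rewrite coef_wedge [RHS](bigID (fun S => #|S| == p)) /= [X in _ = _ + X]big1 ?addr0.
  rewrite !big_mkcondr [RHS]big_mkcond [LHS]big_mkcond /=; apply: eq_bigr => S _.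
  rewrite powersetE; case: ifP => // sS; case: eqP => //= e.
  rewrite coef_homog cardsD (setIidPr sS) e.
  have {e}: (p <= #|U|)%N by rewrite -e subset_leq_card.
  move=> pU; rewrite eqn_sub2rE //.
  by case: ifP; rewrite ?mulr0.
by move=> S /andP[_ /hu ->]; rewrite mulr0 mul0r.
Qed.

Lemma extpow_wedge p q u v : u \in 'Lambda^p(M) -> v \in 'Lambda^q(M) ->
  wedge u v \in 'Lambda^(p + q)(M).
Proof.
move=> hu hv; have := homog_wedge (p + q) v hu.
by rewrite leq_addr addKn (homog_id hv) => <-; exact: homog_in.
Qed.

Lemma ext_lin_in c : ext_lin c \in 'Lambda^1(M).
Proof.
apply: extpow_sum => i _; apply/extpowZ/extpowP => S n; rewrite coef_emon.
by case: (S =P [set i]) n => [->|//]; rewrite cards1.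
Qed.

Lemma ext1_in : ext1 M \in 'Lambda^0(M).
Proof. by apply/extpowP => S n; rewrite coef_emon; case: (S =P finset.set0) n => [->|//]; rewrite cards0. Qed.

Lemma extpow0E u : u \in 'Lambda^0(M) -> u = coef u set0 *: ext1 M.
Proof.
move/extpowP => h; apply: extP => S; rewrite coef_extZ coef_emon.
by case: eqP => [->|/eqP n]; rewrite ?mulr1 ?mulr0 // h // cards_eq0.
Qed.

Lemma coef_ext_lin_wedge c u U : coef (wedge (ext_lin c) u) U =
  \sum_(i in U) (-1) ^+ inversions [set i] (U :\ i) * c i * coef u (U :\ i).
Proof.
rewrite wedge_suml coef_ext_sum [RHS]big_mkcond; apply: eq_bigr => i _ /=.
rewrite wedgeZl coef_extZ coef_wedge; case: ifP => iU.
  rewrite (bigD1 [set i]) ?powersetE ?sub1set //= big1 ?addr0 => [|S /andP[_ /negPf n]].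
    by rewrite coef_emon eqxx mulr1; ring.
  by rewrite coef_emon n mulr0 mul0r.
rewrite big1 ?mulr0 // => S; rewrite powersetE coef_emon; case: eqP => [->|]; last by rewrite mulr0 mul0r.
by rewrite sub1set iU.
Qed.

(* Left contraction, normalized so that it maps [e_i /\ e_S] to
   [c i *: e_S] when [i \notin S]. *)
Definition contraction c u : ext M := mkext M (fun S =>
  \sum_(i | i \notin S) (-1) ^+ inversions [set i] S * c i * coef u (i |: S)).

Lemma coef_contract c u S : coef (contraction c u) S =
  \sum_(i | i \notin S) (-1) ^+ inversions [set i] S * c i * coef u (i |: S).
Proof. exact: Defs.coefE. Qed.

Lemma contractD c u v : contraction c (u + v) = contraction c u + contraction c v.
Proof.
apply: extP => S; rewrite coef_extD !coef_contract -big_split; apply: eq_bigr => i _.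
by rewrite coef_extD mulrDr.
Qed.

Lemma contractZ c a u : contraction c (a *: u) = a *: contraction c u.
Proof.
apply: extP => S; rewrite coef_extZ !coef_contract mulr_sumr; apply: eq_bigr => i _.
by rewrite coef_extZ; ring.
Qed.

Lemma contract0 c : contraction c 0 = 0.
Proof. by rewrite -(scale0r (0 : ext M)) contractZ !scale0r. Qed.

Lemma contract_in c q u :
  u \in 'Lambda^q.+1(M) -> contraction c u \in 'Lambda^q(M).
Proof.
move/extpowP => h; apply/extpowP => S n; rewrite coef_contract big1 // => i iS.
by rewrite h ?mulr0 // cardsU1 iS.
Qed.

(** Contraction is an antiderivation: removing the vector just added gives the scalar, and
    exchanging the two operations costs one sign. *)
Lemma contract_lin_wedge c d u : contraction c (wedge (ext_lin d) u) =
  (\sum_i c i * d i) *: u - wedge (ext_lin d) (contraction c u).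
Proof.
apply: extP => S; rewrite coef_extB coef_extZ coef_ext_lin_wedge [LHS]coef_contract.
pose s i T := inversions [set i] T : nat.
have sU i j T : j \notin T -> s i (j |: T) = ((j < i)%N + s i T)%N.
  by move=> jT; rewrite /s !inversions1l big_setU1.
have sgn n : (-1) ^+ n * (-1) ^+ n = 1 :> R.
  by rewrite -exprD addnn -mul2n exprM sqrrN expr1n expr1n.
pose G i j := (-1) ^+ s i S * c i * ((-1) ^+ s j (i |: (S :\ j)) * d j *
  coef u (i |: (S :\ j))).
(* The index [j = i] of [ext_lin d] gives the scalar term; [G i j] collects the indices [j] in
   [S]. *)
transitivity (\sum_(i | i \notin S) (c i * d i * coef u S + \sum_(j in S) G i j)).
  apply: eq_bigr => i iS; rewrite coef_ext_lin_wedge big_setU1 // mulrDr; congr (_ + _).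
    rewrite setU1K // -/(s i S).
    transitivity (((-1) ^+ s i S * (-1) ^+ s i S) * (c i * d i * coef u S)); first by ring.
    by rewrite sgn mul1r.
  rewrite mulr_sumr; apply: eq_bigr => j jS; rewrite /G /s.
  have nij : i != j by apply: contraNneq iS => ->.
  have -> // : (i |: S) :\ j = i |: (S :\ j).
  apply/setP => x; rewrite !inE; case: (eqVneq x j) => [->|] //=.
  by rewrite orbF eq_sym (negPf nij).
(* The scalar terms with index in [S] do not occur on the left; on the right they cancel against the
   diagonal terms of the wedge product. *)
rewrite big_split /= exchange_big /= [X in X * coef u S](bigID (mem S)) /=.
rewrite [X in X * coef u S]addrC mulrDl -mulr_suml -addrA; congr (_ + _).
rewrite mulr_suml -sumrB; apply: eq_bigr => j jS.
rewrite coef_contract [X in _ - _ * X](bigD1 j) /=; last by rewrite !inE eqxx.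
rewrite setD1K // -/(s j _) mulrDr opprD addrA.
have -> : (-1) ^+ s j (S :\ j) * d j * ((-1) ^+ s j (S :\ j) * c j * coef u S)
    = c j * d j * coef u S.
  transitivity (((-1) ^+ s j (S :\ j) * (-1) ^+ s j (S :\ j)) * (c j * d j * coef u S)); first by ring.
  by rewrite sgn mul1r.
rewrite subrr add0r mulr_sumr -sumrN.
apply: eq_big => [i|i iS].
  by rewrite !inE; case: (eqVneq i j) => [->|]; rewrite ?jS ?andbF //= andbT.
have nij : i != j by apply: contraNneq iS => ->.
rewrite /G -/(s i _) sU ?inE ?negb_and ?iS ?orbT //.
rewrite -{1}(setD1K jS) (sU i) ?setD11 // !exprD.
(* Exactly one of [i < j] and [j < i] contributes an extra sign, so the two terms are opposite. *)
have [lt|gt|/val_inj e] := ltngtP i j; last by rewrite e eqxx in nij.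
  by rewrite expr1 expr0; ring.
by rewrite expr1 expr0; ring.
Qed.

End ExteriorAlgebra.

(** * Ideals as predicates and weakly regular sequences *)

Section IdealPredicates.
Variable R : comNzRingType.
Implicit Types (P : R -> Prop) (a b x : R).

Record is_ideal P : Prop := IsIdeal {
  ideal0 : P 0;
  idealD : forall x y, P x -> P y -> P (x + y);
  idealM : forall a x, P x -> P (a * x) }.

Lemma idealB P x y : is_ideal P -> P x -> P y -> P (x - y).
Proof. by move=> iP hx hy; apply: idealD => //; rewrite -mulN1r; exact: idealM. Qed.

Lemma ideal_sum P (J : Type) (s : seq J) (Q : pred J) (F : J -> R) :
  is_ideal P -> (forall i, Q i -> P (F i)) -> P (\sum_(i <- s | Q i) F i).
Proof. by move=> iP h; elim/big_ind: _ => //; [exact: ideal0 | exact: idealD]. Qed.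

Definition adjoin P a x := exists c, P (x - c * a).

Lemma adjoin_ideal P a : is_ideal P -> is_ideal (adjoin P a).
Proof.
move=> iP; split; first by exists 0; rewrite mul0r subr0; exact: ideal0.
  move=> x y [c hc] [d hd]; exists (c + d).
  by rewrite mulrDl opprD addrACA; exact: idealD.
by move=> b x [c hc]; exists (b * c); rewrite -mulrA -mulrBr; exact: idealM.
Qed.

Lemma adjoin_sub P a x : P x -> adjoin P a x.
Proof. by exists 0; rewrite mul0r subr0. Qed.

Lemma adjoinC P a b : adjoin (adjoin P a) b = adjoin (adjoin P b) a.
Proof.
by apply/funext => x; apply/propext; split=> -[c [d h]]; exists d, c; rewrite addrAC.
Qed.

(* Unlike [regular_seq], the quotient by the last ideal may vanish. *)
Fixpoint weakly_regular P (s : seq R) : Prop :=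
  if s is a :: s' then
    (forall x, P (a * x) -> P x) /\ weakly_regular (adjoin P a) s'
  else True.

Lemma weakly_regular_top P s : (forall x, P x) -> weakly_regular P s.
Proof. by elim: s P => //= a s IH P h; split=> //; apply: IH => x; exact: adjoin_sub. Qed.

(* The exact sequence 0 -> R/P -> R/Q -> R/(Q + xR) -> 0, with multiplication
   by [x] as first map: regularity on both ends implies it in the middle. *)
Lemma weakly_regular_extension P Q x s : is_ideal P -> is_ideal Q ->
  (forall u, P u <-> Q (x * u)) ->
  weakly_regular P s -> weakly_regular (adjoin Q x) s -> weakly_regular Q s.
Proof.
elim: s P Q => //= a s IH P Q iP iQ PQ [rP wP] [rC wC]; split=> [u hu|].
  have [v hv] : adjoin Q x u by apply: rC; exact: adjoin_sub.
  have hxv : Q (x * v).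
    apply/PQ/rP/PQ.
    have -> : x * (a * v) = a * u - a * (u - v * x) by ring.
    by apply: idealB => //; exact: idealM.
  have -> : u = (u - v * x) + x * v by ring.
  exact: idealD.
(* [P + a R] has to be the preimage of [Q + a R] under multiplication by [x]. For the harder
   inclusion, [a] is regular modulo [Q + x R], so [w] is a multiple of [x] modulo [Q]. *)
apply: (IH (adjoin P a)) => //; [exact: adjoin_ideal..| | by rewrite adjoinC].
move=> u; split=> -[w hw].
  by exists (x * w); rewrite -mulrA -mulrBr; apply/PQ.
have [v hv] : adjoin Q x w.
  apply: rC; exists u.
  have -> : a * w - u * x = -1 * (x * u - w * a) by ring.
  exact: idealM.
exists v; apply/PQ.
have -> : x * (u - v * a) = (x * u - w * a) + a * (w - v * x) by ring.
by apply: idealD => //; exact: idealM.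
Qed.

(** Induction on [n]: multiplication by [a] embeds the quotient by [P + a ^+ n R] into the one by
    [P + a ^+ n.+1 R], with cokernel the quotient by [P + a R]. *)
Lemma weakly_regular_power P a n s : is_ideal P ->
  (forall x, P (a * x) -> P x) -> weakly_regular (adjoin P a) s ->
  weakly_regular (adjoin P (a ^+ n)) s.
Proof.
move=> iP ra wa; elim: n => [|n IH].
  by apply: weakly_regular_top => x; exists x; rewrite mulr1 subrr; exact: ideal0.
apply: (@weakly_regular_extension _ _ a) IH _; [exact: adjoin_ideal..| |].
  move=> u; split=> -[c hc]; exists c.
    have -> : a * u - c * a ^+ n.+1 = a * (u - c * a ^+ n) by rewrite exprS; ring.
    exact: idealM.
  by apply: ra; rewrite mulrBr mulrCA -exprS.
have -> // : adjoin (adjoin P (a ^+ n.+1)) a = adjoin P a.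
apply/funext => x; apply/propext; split=> -[c].
  case=> d hd; exists (c + d * a ^+ n).
  by rewrite mulrDl -mulrA -exprSr opprD addrA.
by exists c; exact: adjoin_sub.
Qed.

Lemma regular_power P a n x : (forall y, P (a * y) -> P y) -> P (a ^+ n * x) -> P x.
Proof.
move=> ra; elim: n => [|n IH]; first by rewrite expr0 mul1r.
by rewrite exprS -mulrA => /ra.
Qed.

(** In each binomial term either the exponent of [y] is at least [j] or that of [x] is at least
    [i]. *)
Lemma ideal_powerD P x y i j : is_ideal P ->
  P (x ^+ i) -> P (y ^+ j) -> P ((x + y) ^+ (i + j)).
Proof.
move=> iP hx hy; rewrite exprDn; apply: ideal_sum => // -[h /= _] _.
rewrite -mulr_natl; apply: idealM => //; have [jh|hj] := leqP j h.
  by rewrite -(subnK jh) exprD mulrA; exact: idealM.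
have ih : (i <= i + j - h)%N by lia.
by rewrite mulrC -(subnK ih) exprD mulrA; exact: idealM.
Qed.

(** Each generator adds [n] to the exponent by [ideal_powerD]. The extra 1 is for the empty sum,
    since the zeroth power of 0 is 1. *)
Lemma ideal_span_power P (T : finType) (x : T -> R) (n : nat) a : is_ideal P ->
  (forall i, P (x i ^+ n)) -> ideal_span x a -> P (a ^+ (n * #|T|).+1).
Proof.
move=> iP hx [c ->]; rewrite cardE; rewrite -big_enum /=.
elim: (enum T) => [|i s IH].
  by rewrite big_nil muln0 expr1; exact: ideal0.
rewrite big_cons /= mulnS -addnS; apply: ideal_powerD => //.
by rewrite exprMn; exact: idealM.
Qed.

End IdealPredicates.

(** * Powers of the ideal generated by the forms [omega j], modulo [P] *)

Section FormIdeals.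
Variables (R : comNzRingType) (m : nat) (M : freeModule R m) (k : nat).
Variable omega : 'I_k -> M.
Implicit Types (S T : {set 'I_m}) (u v : ext M) (a b : R) (P : R -> Prop).
Implicit Types (I J L : seq 'I_k).

Local Notation w := (wedge_seq omega).
Local Notation dot c x := (\sum_i c i * coords x 0 i).

Lemma ext_vecE (x : M) : ext_vec x = ext_lin M (coords x 0).
Proof. by []. Qed.

Lemma wedge_seq_nil : w [::] = ext1 M.
Proof. by rewrite /wedge_seq big_nil. Qed.

Lemma wedge_seq_cons j J : w (j :: J) = wedge (ext_vec (omega j)) (w J).
Proof. by rewrite /wedge_seq big_cons. Qed.

Lemma wedge_seq_cat I J : w (I ++ J) = wedge (w I) (w J).
Proof. by rewrite /wedge_seq big_cat. Qed.

Lemma wedge_seq_in J : w J \in 'Lambda^(size J)(M).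
Proof.
elim: J => [|j J IH]; first by rewrite wedge_seq_nil ext1_in.
by rewrite wedge_seq_cons /= -add1n extpow_wedge // ext_vecE ext_lin_in.
Qed.

Lemma wedge_vec_seq (x : M) J :
  wedge (ext_vec x) (w J) = (-1) ^+ size J *: wedge (w J) (ext_vec x).
Proof.
elim: J => [|j J IH]; first by rewrite wedge_seq_nil wedge1x wedgex1 scale1r.
rewrite wedge_seq_cons wedgeA [wedge (ext_vec x) _]ext_lin_anti -scaleN1r.
by rewrite wedgeZl -!wedgeA IH wedgeZr scalerA /= exprS.
Qed.

(** The sign stays existential, since neither divisibility nor vanishing depends on it. *)
Lemma wedge_seq_perm I J : perm_eq I J -> exists e : nat, w I = (-1) ^+ e *: w J.
Proof.
elim: I J => [|i I IH] J.
  by rewrite perm_sym => /perm_nilP ->; exists 0%N; rewrite scale1r.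
move=> h; have iJ : i \in J by rewrite -(perm_mem h) mem_head.
case/splitPr: J / iJ h => J1 J2.
rewrite -[J1 ++ i :: J2]/(J1 ++ [:: i] ++ J2) perm_sym perm_catCA perm_cons perm_sym.
case/IH => e he; exists (e + size J1)%N.
rewrite wedge_seq_cons he wedgeZr !wedge_seq_cat wedgeA wedge_vec_seq.
by rewrite wedgeZl scalerA -exprD -wedgeA wedge_seq_cons wedge_seq_nil wedgex1.
Qed.

Lemma wedge_seq_rep J : ~~ uniq J -> w J = 0.
Proof.
elim: J => //= j J IH; rewrite negb_and negbK => /orP[jJ|/IH e]; last first.
  by rewrite wedge_seq_cons e wedge0r.
have [e he] := wedge_seq_perm (perm_to_rem jJ).
by rewrite wedge_seq_cons he wedge_seq_cons wedgeZr wedgeA ext_lin_sq wedge0l scaler0.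
Qed.

Lemma wedge_seq_long J : (k < size J)%N -> w J = 0.
Proof.
move=> h; apply: wedge_seq_rep; apply: contraL h => /card_uniqP <-.
by rewrite -leqNgt -[X in (_ <= X)%N]card_ord max_card.
Qed.

(** Without repetition, [J] is a permutation of all the indices. *)
Lemma wedge_seq_top J : size J = k ->
  exists a, w J = a *: w (enum 'I_k).
Proof.
move=> sJ; have [uJ|/wedge_seq_rep->] := boolP (uniq J); last first.
  by exists 0; rewrite scale0r.
have [e ->] : exists e : nat, w J = (-1) ^+ e *: w (enum 'I_k).
  apply/wedge_seq_perm/uniq_perm; rewrite ?enum_uniq //.
  apply: (uniq_min_size uJ _ _).2 => [i|]; first by rewrite mem_enum.
  by rewrite sJ size_enum_ord.
by exists ((-1) ^+ e).
Qed.

Lemma contract_wedge_seq c J u : {in J, forall j, dot c (omega j) = 0} ->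
  contraction c (wedge (w J) u) = (-1) ^+ size J *: wedge (w J) (contraction c u).
Proof.
elim: J => [|j J IH] h; first by rewrite wedge_seq_nil !wedge1x scale1r.
rewrite wedge_seq_cons -!wedgeA contract_lin_wedge h ?mem_head // scale0r sub0r.
rewrite IH => [|i iJ]; last by apply: h; rewrite inE iJ orbT.
by rewrite wedgeZr -scaleN1r scalerA /= exprS.
Qed.

Definition zero_mod P u := forall S, P (coef u S).

Section ModuloIdeal.
Variable P : R -> Prop.
Hypothesis iP : is_ideal P.

Lemma zero_mod0 : zero_mod P 0.
Proof. by move=> S; rewrite coef_ext0; exact: ideal0. Qed.

Lemma zero_modD u v : zero_mod P u -> zero_mod P v -> zero_mod P (u + v).
Proof. by move=> hu hv S; rewrite coef_extD; apply: idealD. Qed.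

Lemma zero_modZ a u : zero_mod P u -> zero_mod P (a *: u).
Proof. by move=> hu S; rewrite coef_extZ; apply: idealM. Qed.

Lemma zero_modB u v : zero_mod P u -> zero_mod P v -> zero_mod P (u - v).
Proof. by move=> hu hv S; rewrite coef_extB; apply: idealB. Qed.

Lemma zero_mod_wedge u v : zero_mod P v -> zero_mod P (wedge u v).
Proof.
by move=> hv S; rewrite coef_wedge; apply: ideal_sum => // T _; exact: idealM.
Qed.

Lemma zero_mod_contract c u : zero_mod P u -> zero_mod P (contraction c u).
Proof.
by move=> hu S; rewrite coef_contract; apply: ideal_sum => // T _; exact: idealM.
Qed.

Lemma zero_mod_homog q u : zero_mod P u -> zero_mod P (homog q u).
Proof. by move=> hu S; rewrite coef_homog; case: ifP => // _; exact: ideal0. Qed.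

Lemma zero_mod_regular a n u : (forall x, P (a * x) -> P x) ->
  zero_mod P (a ^+ n *: u) -> zero_mod P u.
Proof.
by move=> ra hu S; apply: (regular_power (n := n) ra); rewrite -coef_extZ.
Qed.

End ModuloIdeal.

(** The [r]-th power of the ideal generated by the forms of [L], modulo [P]. Arbitrary lists [J] and
    inhomogeneous cofactors are allowed; [form_idealP] recovers increasing tuples and degrees. *)
Inductive form_ideal P L (r : nat) : ext M -> Prop :=
| form_ideal_mod u of zero_mod P u : form_ideal P L r u
| form_ideal_gen J u of size J = r & {subset J <= L} :
    form_ideal P L r (wedge (w J) u)
| form_idealD u v of form_ideal P L r u & form_ideal P L r v :
    form_ideal P L r (u + v).

(** Any order and repetitions are allowed in [I], so that lists can be concatenated freely;
    [wedge_vanishP] relates this to increasing tuples. *)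
Definition wedge_zero P L s u := forall I, size I = s -> {subset I <= L} ->
  zero_mod P (wedge (w I) u).

Section FormIdealTheory.
Variable P : R -> Prop.
Hypothesis iP : is_ideal P.

Lemma form_idealZ L r a u : form_ideal P L r u -> form_ideal P L r (a *: u).
Proof.
elim=> [v hv|J v sJ JL|v v' _ h _ h'].
- by apply: form_ideal_mod; apply: zero_modZ.
- by rewrite -wedgeZr; exact: form_ideal_gen.
by rewrite scalerDr; exact: form_idealD.
Qed.

Lemma form_ideal0 L r : form_ideal P L r 0.
Proof. by apply: form_ideal_mod; apply: zero_mod0. Qed.

Lemma form_ideal_sum L r (T : Type) (s : seq T) (Q : pred T) (F : T -> ext M) :
  (forall i, Q i -> form_ideal P L r (F i)) ->
  form_ideal P L r (\sum_(i <- s | Q i) F i).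
Proof.
by move=> h; elim/big_ind: _ => //; [exact: form_ideal0 | exact: form_idealD].
Qed.

Lemma form_ideal_homog L r p u :
  form_ideal P L r u -> form_ideal P L r (homog p u).
Proof.
elim=> [v hv|J v sJ JL|v v' _ h _ h'].
- by apply: form_ideal_mod; apply: zero_mod_homog.
- rewrite (homog_wedge p v (wedge_seq_in J)); case: ifP => _.
    exact: form_ideal_gen.
  exact: form_ideal0.
by rewrite homogD; exact: form_idealD.
Qed.

Lemma form_ideal_low L r p u :
  form_ideal P L r u -> (p < r)%N -> zero_mod P (homog p u).
Proof.
move=> h pr; elim: h => [v hv|J v sJ JL|v v' _ h _ h'].
- by apply: zero_mod_homog.
- rewrite (homog_wedge p v (wedge_seq_in J)) sJ leqNgt pr; exact: zero_mod0.
by rewrite homogD; exact: zero_modD.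
Qed.

Lemma form_ideal_wedge L L' I r u : {subset L' <= L} -> {subset I <= L} ->
  form_ideal P L' r u -> form_ideal P L (size I + r) (wedge (w I) u).
Proof.
move=> LL IL; elim=> [v hv|J v sJ JL|v v' _ h _ h'].
- by apply: form_ideal_mod; apply: zero_mod_wedge.
- rewrite wedgeA -wedge_seq_cat; apply: form_ideal_gen; first by rewrite size_cat sJ.
  by move=> i; rewrite mem_cat => /orP[/IL|/JL/LL].
by rewrite wedgeDr; exact: form_idealD.
Qed.

Lemma form_ideal_subset L L' r u : {subset L' <= L} ->
  form_ideal P L' r u -> form_ideal P L r u.
Proof. by move=> LL /(@form_ideal_wedge L _ [::]); rewrite wedge_seq_nil wedge1x; apply. Qed.

Lemma form_ideal_weaken L r u : form_ideal P L r.+1 u -> form_ideal P L r u.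
Proof.
elim=> [v hv|J v sJ JL|v v' _ h _ h']; [exact: form_ideal_mod| |exact: form_idealD].
rewrite -(cat_take_drop r J) wedge_seq_cat -wedgeA; apply: form_ideal_gen.
  by rewrite size_takel // sJ.
by move=> i /mem_take /JL.
Qed.

Lemma form_ideal_contract L r c u : {in L, forall j, dot c (omega j) = 0} ->
  form_ideal P L r u -> form_ideal P L r (contraction c u).
Proof.
move=> hc; elim=> [v hv|J v sJ JL|v v' _ h _ h'].
- by apply: form_ideal_mod; apply: zero_mod_contract.
- rewrite contract_wedge_seq => [|j /JL]; last exact: hc.
  by apply: form_idealZ; apply: form_ideal_gen.
by rewrite contractD; exact: form_idealD.
Qed.

(** More than [k] forms contain a repetition. This gives the implications towards (B). *)
Lemma form_ideal_wedge_zero L L' r s u : (k < s + r)%N ->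
  form_ideal P L r u -> wedge_zero P L' s u.
Proof.
move=> sr h I sI _; elim: h => [v hv|J v sJ JL|v v' _ h _ h'].
- exact: zero_mod_wedge.
- rewrite wedgeA -wedge_seq_cat wedge_seq_long ?size_cat ?sI ?sJ //.
  by rewrite wedge0l; exact: zero_mod0.
by rewrite wedgeDr; exact: zero_modD.
Qed.

(* Contraction with a covector [c] dual to [omega j] and killing the other
   forms satisfies [a u = omega j /\ c u + c (omega j /\ u)]; the first summand
   lowers [r] and the second one lowers [s]. *)
Lemma form_ideal_scaled L a r s u : uniq L -> (r + s = (size L).+1)%N ->
  {in L, forall j, exists2 c : 'I_m -> R, dot c (omega j) = a &
     {in L, forall i, i != j -> dot c (omega i) = 0}} ->
  wedge_zero P L s u -> form_ideal P L r (a ^+ size L *: u).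
Proof.
elim: L r s u => [|j L IH] [|r] [|s] u //.
(* For [r = 0] the empty product divides everything. For [s = 0] the hypothesis on the empty product
   says that [u] vanishes modulo [P]. If both are positive, [L] cannot be empty. *)
all: try by move=> *; apply: form_idealZ; rewrite -[u]wedge1x -wedge_seq_nil;
  exact: form_ideal_gen.
all: try by move=> _ _ _ /(_ [::] erefl) h; apply: form_idealZ => //; apply: form_ideal_mod;
  rewrite -[u]wedge1x -wedge_seq_nil; exact: h.
  by rewrite addSn addnS.
move=> /= /andP[jL uL] rs dual hu.
have Lsub : {subset L <= j :: L} by move=> i; rewrite inE => ->; rewrite orbT.
have dualL : {in L, forall i, exists2 c : 'I_m -> R, dot c (omega i) = a &
     {in L, forall i', i' != i -> dot c (omega i') = 0}}.
  by move=> i /Lsub /dual[c ca c0]; exists c => // i' /Lsub; exact: c0.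
have [c ca c0] := dual j (mem_head _ _).
have cL : {in L, forall i, dot c (omega i) = 0}.
  by move=> i iL; apply: c0 (Lsub _ iL) _; apply: contraNneq jL => <-.
have jsub : {subset [:: j] <= j :: L} by move=> i; rewrite inE => /eqP->; exact: mem_head.
rewrite exprSr -scalerA -ca -[_ *: u](subrK (wedge (ext_vec (omega j)) (contraction c u))).
rewrite -contract_lin_wedge -ext_vecE ca addrC scalerDr; apply: form_idealD.
  rewrite -wedgeZr -[ext_vec _](wedgex1 (M := M)) -wedge_seq_nil -wedge_seq_cons.
  apply: (form_ideal_wedge (r := r) Lsub jsub); apply: (IH r s.+1) => // [|I sI IL].
    by lia.
  have -> : wedge (w I) (contraction c u) = (-1) ^+ size I *: contraction c (wedge (w I) u).
    rewrite contract_wedge_seq => [|i /IL]; last exact: cL.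
    by rewrite scalerA -exprD addnn -mul2n exprM sqrrN !expr1n scale1r.
  by apply: zero_modZ => //; apply: zero_mod_contract => //; apply: hu => // i /IL /Lsub.
rewrite -contractZ; apply: (form_ideal_subset Lsub); apply: form_ideal_contract => //.
apply: (IH r.+1 s) => // [|I sI IL]; first by lia.
have -> : wedge (w I) (wedge (ext_vec (omega j)) u) = wedge (w (I ++ [:: j])) u.
  by rewrite wedge_seq_cat wedge_seq_cons wedge_seq_nil wedgex1 wedgeA.
apply: hu; first by rewrite size_cat addn1 sI.
by move=> i; rewrite mem_cat => /orP[/IL/Lsub|/jsub].
Qed.

End FormIdealTheory.

Local Notation Omega := (wedge_all omega).

Lemma wedge_allE : Omega = w (enum 'I_k).
Proof. by rewrite /wedge_all [index_enum _]unlock -enumT. Qed.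

(* The covector sends [x] to the coefficient, up to sign, of [Omega] with
   [omega j] replaced by [x]. *)
Lemma dual_covector S (j : 'I_k) : exists2 c : 'I_m -> R,
  dot c (omega j) = coef Omega S & forall i, i != j -> dot c (omega i) = 0.
Proof.
have jk : j \in enum 'I_k by rewrite mem_enum.
have [e he] := wedge_seq_perm (perm_to_rem jk).
pose c i := (-1) ^+ e * coef (wedge (emon M [set i]) (w (rem j (enum 'I_k)))) S.
have cE (x : M) : dot c x =
    (-1) ^+ e * coef (wedge (ext_vec x) (w (rem j (enum 'I_k)))) S.
  rewrite /ext_vec wedge_suml coef_ext_sum mulr_sumr; apply: eq_bigr => i _.
  by rewrite wedgeZl coef_extZ /c; ring.
exists c; first by rewrite cE -wedge_seq_cons -coef_extZ -he wedge_allE.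
move=> i ij; rewrite cE -wedge_seq_cons wedge_seq_rep ?coef_ext0 ?mulr0 //=.
by rewrite mem_rem_uniq ?enum_uniq // !inE ij mem_enum.
Qed.

(** The scalars [c] with [c *: u] divisible form an ideal, which contains the [k]-th power of each
    coefficient of [Omega]; [ideal_span_power] then applies. The exponent depends neither on [a] nor
    on [u]. *)
Lemma form_ideal_power P r s u a : is_ideal P -> (r + s = k.+1)%N ->
  wedge_zero P (enum 'I_k) s u -> coef_ideal Omega a ->
  form_ideal P (enum 'I_k) r (a ^+ (k * #|{set 'I_m}|).+1 *: u).
Proof.
move=> iP rs hu; apply: (ideal_span_power (P := fun c => form_ideal P _ r (c *: u))).
  split=> [|x y hx hy|b x hx]; first by rewrite scale0r; exact: form_ideal0.
    by rewrite scalerDl; exact: form_idealD.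
  by rewrite -scalerA; exact: form_idealZ.
move=> S; have := @form_ideal_scaled _ iP (enum 'I_k) (coef Omega S) r s u.
rewrite size_enum_ord enum_uniq; apply=> // j _.
by have [c c1 c2] := dual_covector S j; exists c => // i _; exact: c2.
Qed.

End FormIdeals.

(** * Division along a weakly regular sequence *)

Section Division.
Variables (R : comNzRingType) (m : nat) (M : freeModule R m) (k : nat).
Variable omega : 'I_k -> M.
Implicit Types (u v : ext M) (a b : R) (P : R -> Prop) (I : seq 'I_k).

Local Notation w := (wedge_seq omega).
Local Notation Omega := (wedge_all omega).
Local Notation all_forms := (enum 'I_k).

Lemma sub_all_forms I : {subset I <= all_forms}.
Proof. by move=> i _; rewrite mem_enum. Qed.
Hint Resolve sub_all_forms : core.

Lemma increasing_uniq n q (t : q.-tuple 'I_n) : increasing t -> uniq t.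
Proof.
rewrite /increasing ltn_sorted_uniq_leq => /andP[+ _].
by rewrite (map_inj_uniq val_inj).
Qed.

Lemma increasing_inj n q (t t' : q.-tuple 'I_n) :
  increasing t -> increasing t' -> {subset t <= t'} -> t = t'.
Proof.
move=> it it' sub; apply/val_inj/(inj_map val_inj).
have e := (uniq_min_size (increasing_uniq it) sub _).2.
apply: (irr_sorted_eq ltn_trans ltnn) => //.
by apply: eq_mem_map; apply: e; rewrite !size_tuple.
Qed.

Lemma exists_increasing n q (J : seq 'I_n) : uniq J -> size J = q ->
  exists2 t : q.-tuple 'I_n, increasing t & perm_eq J t.
Proof.
move=> uJ sJ; pose le (i j : 'I_n) := (i <= j)%N.
have st : size (sort le J) == q by rewrite size_sort sJ.
exists (Tuple st); last by rewrite perm_sym perm_sort.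
rewrite /increasing ltn_sorted_uniq_leq map_inj_uniq ?sort_uniq ?uJ //=; last exact: val_inj.
by rewrite sorted_map; apply: sort_sorted => i j; exact: leq_total.
Qed.

(** Products with a repeated index vanish and the others are sorted at the cost of a sign;
    projecting to degree [p] then makes the cofactors homogeneous. *)
Lemma form_idealP P r p u : is_ideal P -> form_ideal omega P all_forms r u ->
  u \in 'Lambda^p(M) -> exists2 gamma : r.-tuple 'I_k -> ext M,
    (forall J, gamma J \in 'Lambda^(p - r)(M)) &
    zero_mod P (u - \sum_(J : r.-tuple 'I_k | increasing J) wedge (w J) (gamma J)).
Proof.
move=> iP hu up.
have [gamma hg] : exists gamma : r.-tuple 'I_k -> ext M,
    zero_mod P (u - \sum_(J : r.-tuple 'I_k | increasing J) wedge (w J) (gamma J)).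
  elim: hu {up} => [v hv|J v sJ _|v v' _ [g hg] _ [g' hg']].
  - exists (fun=> 0); rewrite big1 ?subr0 // => J _; exact: wedge0r.
  - have [uJ|/wedge_seq_rep->] := boolP (uniq J); last first.
      exists (fun=> 0); rewrite big1 => [|? _]; last exact: wedge0r.
      by rewrite subr0 wedge0l; exact: zero_mod0.
    have [t it /(wedge_seq_perm omega)[e ->]] := exists_increasing uJ sJ.
    exists (fun t' => if t' == t then (-1) ^+ e *: v else 0).
    rewrite (bigD1 t) //= eqxx big1 => [|t' /andP[_ /negPf->]]; last exact: wedge0r.
    by rewrite addr0 wedgeZl wedgeZr subrr; exact: zero_mod0.
  exists (fun J => g J + g' J).
  under eq_bigr do rewrite wedgeDr.
  by rewrite big_split opprD addrACA; exact: zero_modD.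
(* For [p < r] the truncated difference [p - r] is 0 and would keep the degree 0 parts, so the
   cofactors are set to 0. *)
exists (fun J => if (r <= p)%N then homog (p - r) (gamma J) else 0).
  by move=> J; case: ifP => _; [exact: homog_in | exact: extpow0].
have -> : u - \sum_(J : r.-tuple 'I_k | increasing J)
      wedge (w J) (if (r <= p)%N then homog (p - r) (gamma J) else 0) =
    homog p (u - \sum_(J : r.-tuple 'I_k | increasing J) wedge (w J) (gamma J)).
  rewrite -scaleN1r homogD (homog_id up) -scaleN1r !scaler_sumr; congr (_ + _).
  rewrite (big_morph (homog p) (homogD p) (homog0 M p)); apply: eq_bigr => J _.
  rewrite -!wedgeZr (homog_wedge p _ (wedge_seq_in omega J)) size_tuple.
  case: ifP => _; last by rewrite scaler0 wedge0r.
  by congr wedge; apply: extP => S; rewrite coef_extZ !coef_homog coef_extZ; case: ifP; rewrite ?mulr0.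
exact: zero_mod_homog.
Qed.

(* Multiplying by the product of the forms not in [J] isolates the term of
   index [J]. *)
Lemma wedge_all_zero_mod P r (c : r.-tuple 'I_k -> ext M) : is_ideal P ->
  zero_mod P (\sum_(J : r.-tuple 'I_k | increasing J) wedge (w J) (c J)) ->
  forall J, increasing J -> zero_mod P (wedge Omega (c J)).
Proof.
move=> iP h J iJ; pose I := [seq i <- all_forms | i \notin J].
have kill (J' : r.-tuple 'I_k) : increasing J' -> J' != J ->
    wedge (w I) (w J') = 0.
  move=> iJ'; rewrite -wedge_seq_cat => neq; apply: wedge_seq_rep.
  apply: contra neq => uIJ; apply/eqP/increasing_inj => // i iJ''.
  move: uIJ; rewrite cat_uniq => /and3P[_ /hasPn/(_ i iJ'') + _].
  by rewrite mem_filter mem_enum andbT negbK.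
have [e he] : exists e : nat, Omega = (-1) ^+ e *: w (I ++ J).
  rewrite wedge_allE; apply/wedge_seq_perm; rewrite perm_sym.
  apply: uniq_perm; rewrite ?enum_uniq //.
    rewrite cat_uniq filter_uniq ?enum_uniq // increasing_uniq // andbT.
    by apply/hasPn => i iJ'; rewrite mem_filter iJ'.
  by move=> i; rewrite mem_cat mem_filter mem_enum /= andbT orNb.
rewrite he wedgeZl; apply: zero_modZ => //.
have := zero_mod_wedge iP (w I) h.
rewrite wedge_sumr (bigD1 J) //= big1 => [|J' /andP[iJ' n]].
  by rewrite addr0 wedgeA wedge_seq_cat.
by rewrite wedgeA kill ?wedge0l.
Qed.

Lemma wedge_all_wedge_zero P u : is_ideal P ->
  zero_mod P (wedge Omega u) -> wedge_zero omega P all_forms k u.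
Proof.
move=> iP h I sI _; have [a ->] := wedge_seq_top omega sI.
by rewrite wedgeZl -wedge_allE; exact: zero_modZ.
Qed.

(** Only the elements vanishing modulo [adjoin P b] need a correction, and the multipliers of [b] in
    their coefficients provide it. *)
Lemma form_ideal_adjoin P b L r u : form_ideal omega (adjoin P b) L r u ->
  exists v, form_ideal omega P L r (u - b *: v).
Proof.
elim=> [v hv|J v sJ JL|v v' _ [x h] _ [x' h']].
- have [c hc] := choice hv; exists (mkext M c); apply: form_ideal_mod => S.
  by rewrite coef_extB coef_extZ Defs.coefE mulrC.
- by exists 0; rewrite scaler0 subr0; exact: form_ideal_gen.
by exists (x + x'); rewrite scalerDr opprD addrACA; exact: form_idealD.
Qed.

(* Induction on [n]: a power [b] of the first element of [l] satisfies
   [b u = \sum_J w J /\ gamma J] mod [P]. Modulo [adjoin P b] each [gamma J] is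
   annihilated by [Omega], hence lies in the ideal of the forms [omega j], by
   induction. So after subtracting some [\sum_J w J /\ v J], [b u] is in the
   ideal of the products of [r.+1] forms, and induction applies again. *)
Lemma form_ideal_division n P r s p u (l : seq R) : is_ideal P ->
  (r + s = k.+1)%N -> (p < r + n)%N -> u \in 'Lambda^p(M) -> (n < size l)%N ->
  {in l, forall a, coef_ideal Omega a} -> weakly_regular P l ->
  wedge_zero omega P all_forms s u -> form_ideal omega P all_forms r u.
Proof.
elim: n P r s p u l => [|n IH] P r s p u [|a l] //= iP rs pr up sl lO [ra wl] hu.
all: have aO : coef_ideal Omega a by apply: lO; exact: mem_head.
all: have := form_ideal_power iP rs hu aO.
all: move: (k * _).+1 => N hN.
  (* Here [p < r], and products of [r] forms have no component of degree [p]. So [a ^+ N *: u] is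
     zero modulo [P], and the regular [a] can be cancelled. *)
  apply/form_ideal_mod/(zero_mod_regular (n := N) ra).
  rewrite addn0 in pr; have := form_ideal_low iP hN pr.
  by rewrite (homog_id (extpowZ _ up)).
case: s rs hu => [|s] rs hu.
  by apply: form_ideal_mod; rewrite -[u]wedge1x -(wedge_seq_nil omega); exact: hu.
have [gamma gin gE] := form_idealP iP hN (extpowZ _ up).
set b := a ^+ N in hN gE.
have iPb := adjoin_ideal b iP.
have wb : weakly_regular (adjoin P b) l by exact: weakly_regular_power.
have lO' : {in l, forall a, coef_ideal Omega a}.
  by move=> x xl; apply: lO; rewrite inE xl orbT.
have hg (J : r.-tuple 'I_k) : exists v, increasing J ->
    form_ideal omega P all_forms 1 (gamma J - b *: v).
  have [iJ|_] := boolP (increasing J); last by exists 0.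
  have [|v hv] := @form_ideal_adjoin P b all_forms 1 (gamma J); last by exists v.
  (* First use of the induction: [gamma J] has degree [p - r], and being annihilated by [Omega] is
     the case [r = 1], [s = k]. *)
  apply: (IH _ 1%N k (p - r)%N _ l iPb) => //; first by lia.
  apply: wedge_all_wedge_zero => //; move: J iJ; apply: wedge_all_zero_mod => // S.
  (* The sum of the [w J /\ gamma J] equals [b *: u] modulo [P], hence vanishes modulo
     [adjoin P b]. *)
  exists (coef u S); have := idealM iP (-1) (gE S).
  by rewrite coef_extB coef_extZ mulN1r opprB [_ * b]mulrC.
have {hg} [v hv] := choice hg.
pose u1 := \sum_(J : r.-tuple 'I_k | increasing J) wedge (w J) (v J).
have hu1 : form_ideal omega P all_forms r.+1 (b *: (u - u1)).
  (* Up to a remainder in [P], this is the sum of the [w J /\ (gamma J - b *: v J)], where each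
     cofactor supplies one more form. *)
  rewrite -[X in form_ideal _ _ _ _ X](subrK (\sum_(J : r.-tuple 'I_k | increasing J)
    wedge (w J) (gamma J - b *: v J))) addrC.
  apply: form_idealD.
    apply: form_ideal_sum => // J iJ.
    by have := form_ideal_wedge iP (sub_all_forms (I := all_forms)) (sub_all_forms (I := J)) (hv J iJ);
       rewrite size_tuple addn1.
  apply: form_ideal_mod.
  under eq_bigr do rewrite wedgeBr wedgeZr.
  by rewrite sumrB -scaler_sumr scalerBr opprB addrA subrK.
have u1r : form_ideal omega P all_forms r u1.
  by apply: form_ideal_sum => // J _; apply: form_ideal_gen => //; rewrite size_tuple.
(* The [v J] need not be homogeneous, so the component of degree [p] is taken. *)
pose u2 := homog p (u - u1).
have bu2 : b *: u2 = homog p (b *: (u - u1)).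
  by apply: extP => S; rewrite coef_extZ !coef_homog coef_extZ; case: ifP; rewrite ?mulr0.
have -> : u = u2 + homog p u1 by rewrite /u2 -homogD subrK homog_id.
apply: form_idealD; last exact: form_ideal_homog.
apply: form_ideal_weaken.
(* Second use of the induction, with the whole sequence: raising [r] compensates for lowering [n].
   Products of [s] forms kill [b *: u2] because [s + r.+1] exceeds [k], and [b] is regular modulo
   [P]. *)
apply: (IH _ r.+1 s p _ (a :: l)) => //; [by lia | by lia | exact: homog_in | exact: ltnW | ].
move=> I sI _; apply: (zero_mod_regular (n := N) ra).
rewrite -wedgeZr -/b bu2.
apply: (@form_ideal_wedge_zero _ _ _ _ omega P iP all_forms all_forms r.+1 s) => //.
  by lia.
exact: form_ideal_homog.
Qed.

End Division.

(** * Evaluation of exterior elements on covectors *)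

Section Forms.
Variables (R : comNzRingType) (m : nat) (M : freeModule R m).
Implicit Types (S T : {set 'I_m}) (u v : ext M).

Lemma enum_set_sorted S : sorted ltn (map val (enum S)).
Proof.
apply: (subseq_sorted ltn_trans) (iota_ltn_sorted 0 m).
by rewrite -val_enum_ord; apply: map_subseq; rewrite {1}/enum_mem -enumT filter_subseq.
Qed.

Lemma enum_increasing q (t : q.-tuple 'I_m) :
  increasing t -> enum [set i in t] = t.
Proof.
move=> it; apply/(inj_map val_inj)/(irr_sorted_eq ltn_trans ltnn) => //.
  exact: enum_set_sorted.
by apply: eq_mem_map => i; rewrite mem_enum inE.
Qed.

Lemma sum_increasing q (F : {set 'I_m} -> R) :
  \sum_(t : q.-tuple 'I_m | increasing t) F [set i in t] =
  \sum_(S : {set 'I_m} | #|S| == q) F S.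
Proof.
rewrite -(@big_imset _ _ _ _ _ (fun t : q.-tuple 'I_m => [set i in t])
  [pred t | increasing t]) /=; last first.
  move=> t t' /= it it' e; apply: increasing_inj => // i it'i.
  have : i \in [set i in t] by rewrite inE.
  by rewrite e inE.
apply: eq_bigl => S; apply/imsetP/eqP => [[t it ->]|sS].
  have := enum_increasing it; rewrite cardE => ->; exact: size_tuple.
have [t it p] := exists_increasing (enum_uniq S) (etrans (esym (cardE _)) sS).
exists t => //; apply/setP => i.
by rewrite inE -(perm_mem p) mem_enum.
Qed.

(** The columns are listed without any condition on the length; the default 0 fills missing
    entries. *)
Definition minor q (G : 'I_q -> 'I_m -> R) (s : seq 'I_m) : R :=
  \det (\matrix_(i < q, j < q) nth 0 (map (G i) s) j).

(** This identifies the sign given by [inversions] with the sign of a cofactor. *)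
Lemma count_lt_sorted (s1 s2 : seq 'I_m) x :
  sorted ltn (map val (s1 ++ x :: s2)) ->
  count (fun i : 'I_m => i < x)%N (s1 ++ x :: s2) = size s1.
Proof.
rewrite sorted_map sorted_pairwise; last by move=> j i h; exact: ltn_trans.
rewrite pairwise_cat => /and3P[/allrelP h1 _ /= /andP[/allP h2 _]].
rewrite count_cat /= ltnn add0n.
have /eq_in_count-> : {in s1, (fun i : 'I_m => i < x)%N =1 predT}.
  by move=> i i1; apply: h1 => //; exact: mem_head.
have /eq_in_count-> : {in s2, (fun i : 'I_m => i < x)%N =1 pred0}.
  by move=> i /h2 /= lt; rewrite ltnNge (ltnW lt).
by rewrite count_predT count_pred0 addn0.
Qed.

(** Laplace expansion along the first row: the position of the column [i] is the number of elements
    of [T] below [i]. *)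
Lemma minor_expand q (G : 'I_q.+1 -> 'I_m -> R) T : #|T| = q.+1 ->
  minor G (enum T) = \sum_(i in T) (-1) ^+ inversions [set i] (T :\ i) *
    G ord0 i * minor (fun h => G (lift ord0 h)) (enum (T :\ i)).
Proof.
move=> cT; have sT : size (enum T) = q.+1 by rewrite -cardE.
have [i0 _] : exists i0, i0 \in T by apply/card_gt0P; rewrite cT.
rewrite -[RHS]big_enum /= (big_nth i0) sT big_mkord.
rewrite /minor (expand_det_row _ ord0); apply: eq_bigr => j _.
rewrite /cofactor mxE add0n mulrA (nth_map i0) ?sT //.
have jT : (j < size (enum T))%N by rewrite sT.
set x := nth i0 (enum T) j.
have sp : enum T = take j (enum T) ++ x :: drop j.+1 (enum T).
  by rewrite -drop_nth // cat_take_drop.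
have s1 : size (take j (enum T)) = j by rewrite size_takel // ltnW.
have xT : x \in T by rewrite -mem_enum; exact: mem_nth.
have inv : inversions [set x] (T :\ x) = j.
  rewrite inversions1l -[RHS]s1 -(@count_lt_sorted _ (drop j.+1 (enum T)) x) -?sp; last exact: enum_set_sorted.
  have -> : (\sum_(i in T :\ x) (i < x))%N = (\sum_(i in T) (i < x))%N.
    by rewrite [RHS](big_setD1 x) //= ltnn.
  by rewrite -[LHS]big_enum /= -sumn_count sumnE big_map.
have rem : enum (T :\ x) = take j (enum T) ++ drop j.+1 (enum T).
  have -> : enum (T :\ x) = rem x (enum T).
    rewrite rem_filter ?enum_uniq // /enum_mem -filter_predI.
    by apply: eq_filter => i /=; rewrite !inE.
  have : uniq (enum T) by exact: enum_uniq.
  rewrite {1 2}sp; elim: (take j _) => [|y t IH] /=; first by rewrite eqxx.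
  rewrite mem_cat inE !negb_or => /andP[/and3P[_ n _] /IH ->].
  by rewrite (negPf n).
rewrite inv [G _ _ * _]mulrC; congr (_ * \det _).
apply/matrixP => h l; rewrite !mxE rem {1}sp !map_cat /= !nth_cat !size_map s1.
rewrite /= /bump; case: (leqP j l) => jl.
  by rewrite add1n ltnNge leqW //= subSn.
by rewrite add0n jl.
Qed.

Lemma ext_formE q u (g : 'I_q -> {linear M -> R^o}) : ext_form u g =
  \sum_(S : {set 'I_m} | #|S| == q) coef u S * minor (fun i l => g i (basis M l)) (enum S).
Proof.
rewrite -(sum_increasing q (fun S => coef u S * minor _ (enum S))).
apply: eq_bigr => t it; rewrite enum_increasing //; congr (_ * \det _).
by apply/matrixP => i j; rewrite !mxE (nth_map (tnth t j)) ?size_tuple // -tnth_nth.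
Qed.

(** Expand along the row of [g ord0]; the pairs with [i \in T] correspond to those with [i \notin S]
    through [S = T :\ i]. *)
Lemma ext_form_contract q u (g : 'I_q.+1 -> {linear M -> R^o}) :
  ext_form u g = @ext_form _ _ M q (contraction (fun l => (g ord0 (basis M l) : R)) u)
    (fun i : 'I_q => g (lift ord0 i)).
Proof.
rewrite !ext_formE.
under eq_bigr => T /eqP cT do rewrite minor_expand // mulr_sumr.
under [RHS]eq_bigr => S _ do rewrite coef_contract mulr_suml.
rewrite !pair_big_dep /=.
rewrite [LHS](reindex_onto (fun x : {set 'I_m} * 'I_m => (x.2 |: x.1, x.2))
  (fun x : {set 'I_m} * 'I_m => (x.1 :\ x.2, x.2))) /=; last first.
  by move=> [T i] /= /andP[_ iT]; rewrite setD1K.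
apply: eq_big => [[S i] /=|[S i] /= /andP[/andP[_ _] /eqP[e]]].
  rewrite setU11 andbT xpair_eqE eqxx andbT cardsU1.
  case: (boolP (i \in S)) => iS /=; last by rewrite setU1K // eqxx andbT.
  by rewrite andbF; apply/andP => -[_ /eqP e]; rewrite -e setD11 in iS.
by rewrite e; ring.
Qed.

Lemma ext_form_homog q u (g : 'I_q -> {linear M -> R^o}) :
  ext_form (homog q u) g = ext_form u g.
Proof. by rewrite !ext_formE; apply: eq_bigr => S h; rewrite coef_homog h. Qed.

Lemma ext_formD q u v (g : 'I_q -> {linear M -> R^o}) :
  ext_form (u + v) g = ext_form u g + ext_form v g.
Proof.
by rewrite !ext_formE -big_split; apply: eq_bigr => S _; rewrite coef_extD mulrDl.
Qed.

Lemma ext_formZ q a u (g : 'I_q -> {linear M -> R^o}) :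
  ext_form (a *: u) g = a * ext_form u g.
Proof.
by rewrite !ext_formE mulr_sumr; apply: eq_bigr => S _; rewrite coef_extZ mulrA.
Qed.

Lemma dual_coords (g : {linear M -> R^o}) (x : M) :
  \sum_i (g (basis M i) : R) * coords x 0 i = g x.
Proof.
rewrite -{2}[x]coords_sum linear_sum; apply: eq_bigr => i _.
by rewrite linearZ mulrC.
Qed.

Lemma ext_form0 u (g : 'I_0 -> {linear M -> R^o}) : ext_form u g = coef u finset.set0.
Proof.
rewrite ext_formE (big_pred1 finset.set0) => [|S]; last by rewrite /= cards_eq0.
by rewrite /minor det_mx00 mulr1.
Qed.

(** Contractions with the [g i] pass through [x] up to sign, and in the end a multiple of [x] has no
    coefficient of degree 0. *)
Lemma ext_form_wedge_vec q (x : M) u (g : 'I_q -> {linear M -> R^o}) :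
  (forall i, g i x = 0) -> ext_form (wedge (ext_vec x) u) g = 0.
Proof.
elim: q u g => [|q IH] u g h.
  rewrite ext_form0 (coef_ext_lin_wedge _ _ finset.set0) big1 // => i.
  by rewrite inE.
rewrite ext_form_contract contract_lin_wedge dual_coords h scale0r sub0r.
by rewrite -scaleN1r ext_formZ IH ?mulr0.
Qed.

End Forms.

(** * Restriction to the common kernel of the [omega j] *)

Section FormsOnKernel.
Variables (R : comNzRingType) (m : nat) (M : freeModule R m) (k : nat).
Variable omega : 'I_k -> M.

(* Contracting [Omega /\ u = 0] successively with the covectors [g i], which
   kill all the [omega j], gives [Omega * u(g) = 0]. *)
Lemma ext_form_annihilated q (u : ext M) (g : 'I_q -> {linear M -> R^o}) S :
  u \in 'Lambda^q(M) -> in_kernels omega g -> wedge (wedge_all omega) u = 0 ->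
  coef (wedge_all omega) S * ext_form u g = 0.
Proof.
elim: q u g => [|q IH] u g hu hg h0.
  rewrite ext_form0 mulrC -coef_extZ -[in LHS](wedgex1 (wedge_all omega)) -wedgeZr.
  by rewrite -extpow0E // h0 coef_ext0.
rewrite ext_form_contract; apply: IH => [|i j|]; [exact: contract_in | exact: hg |].
pose c l : R := g ord0 (basis M l); rewrite -/c.
have sgn : (-1) ^+ size (enum 'I_k) * (-1) ^+ size (enum 'I_k) = 1 :> R.
  by rewrite -exprD addnn -mul2n exprM sqrrN !expr1n.
have : contraction c (wedge (wedge_all omega) u) = 0 by rewrite h0 contract0.
rewrite wedge_allE contract_wedge_seq => [h|j _]; last by rewrite dual_coords.
by rewrite -[LHS]scale1r -sgn -scalerA h scaler0.
Qed.

(** Multiples of the [omega j] vanish on the common kernel, so only the part in [P] is left, and it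
    does not depend on [g]. *)
Lemma form_ideal_on_kernel P L q (u : ext M) : is_ideal P ->
  form_ideal omega P L 1 u -> exists2 v : ext M, zero_mod P v &
  forall g : 'I_q -> {linear M -> R^o}, in_kernels omega g ->
    ext_form u g = ext_form v g.
Proof.
move=> iP; elim=> [v hv|J v sJ _|v v' _ [x hx hxg] _ [y hy hyg]].
- by exists v.
- exists 0 => [|g hg]; first exact: zero_mod0.
  case: J sJ => [|j []] // _; rewrite -(scale0r (0 : ext M)) ext_formZ mul0r.
  rewrite wedge_seq_cons wedge_seq_nil wedgex1.
  by apply: ext_form_wedge_vec => i; exact: hg.
exists (x + y) => [|g hg]; first exact: zero_modD.
by rewrite !ext_formD hxg // hyg.
Qed.

End FormsOnKernel.

(** * Depth, regular sequences and fractions *)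

Section Depth.
Variable A : comNzRingType.
Implicit Types (s : seq A) (x y a : A).

(** Coefficients indexed by [nat] can be kept when the length of the sequence changes. *)
Lemma seq_idealP s y :
  seq_ideal s y <-> exists c : nat -> A, y = \sum_(i < size s) c i * s`_i.
Proof.
split=> -[c ->]; last by exists (fun i : 'I_(size s) => c i).
exists (fun i => if insub i is Some j then c j else 0).
by apply: eq_bigr => i _; rewrite valK.
Qed.

Lemma seq_ideal_nil : seq_ideal [::] = (fun x => x = 0).
Proof.
apply/funext => x; apply/propext; split; first by case=> c ->; rewrite big_ord0.
by move=> ->; exists (fun=> 0); rewrite big_ord0.
Qed.

Lemma seq_ideal_rcons s a : seq_ideal (rcons s a) = adjoin (seq_ideal s) a.
Proof.
apply/funext => y; apply/propext; split.
  case/seq_idealP => c ->; exists (c (size s)); apply/seq_idealP; exists c.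
  rewrite size_rcons big_ord_recr /= nth_rcons ltnn eqxx addrK.
  by apply: eq_bigr => i _; rewrite nth_rcons ltn_ord.
case=> d /seq_idealP[c e]; apply/seq_idealP.
exists (fun i => if (i < size s)%N then c i else d).
rewrite size_rcons big_ord_recr /= nth_rcons ltnn eqxx -[y](subrK (d * a)) e.
by congr (_ + _); apply: eq_bigr => i _; rewrite nth_rcons ltn_ord.
Qed.

Lemma regular_seq_weakly s : regular_seq s -> weakly_regular (fun x => x = 0) s.
Proof.
case=> _; rewrite -seq_ideal_nil.
(* Induction requires a prefix [s1] whose terms have already been adjoined. *)
suff h s1 s2 : (forall i, (i < size (s1 ++ s2))%N -> forall x,
    seq_ideal (take i (s1 ++ s2)) ((s1 ++ s2)`_i * x) ->
    seq_ideal (take i (s1 ++ s2)) x) -> weakly_regular (seq_ideal s1) s2.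
  exact: (h [::]).
elim: s2 s1 => //= a s2 IH s1 h; split=> [x|].
  have := h (size s1); rewrite size_cat -addSnnS leq_addr take_size_cat //.
  by rewrite nth_cat ltnn subnn; apply.
by rewrite -seq_ideal_rcons; apply: IH; rewrite cat_rcons.
Qed.

Lemma depth_weakly_regular (I : set A) (n : nat) : (n%:Z%:E <= depth I)%E ->
  exists2 s, (n <= size s)%N & {in s, forall x, I x} /\ weakly_regular (fun x => x = 0) s.
Proof.
rewrite /depth; case: asboolP => [-> _|_ hn].
  (* If [I] is the whole ring, the constant sequence 1 serves, the quotient being zero after its
     first term. *)
  exists (nseq n 1); rewrite ?size_nseq //; split=> //.
  case: n => //= n; split=> [x|]; first by rewrite mul1r.
  by apply: weakly_regular_top => x; exists x; rewrite mulr1 subrr.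
apply: contrapT => no.
set X := [set _ | _]%classic in hn.
case: n => [|n] in hn no *; first by apply: no; exists [::].
(* If no sequence reaches length [n.+1], then [n] bounds all the lengths and thus the supremum. *)
have ub : ubound X n%:Z%:E.
  move=> _ [s [rs sI ->]]; rewrite lee_fin lez_nat leqNgt; apply/negP => ns.
  by apply: no; exists s => //; split; [exact: sI | exact: regular_seq_weakly].
have : (supremum -oo X <= n%:Z%:E)%E.
  rewrite /supremum; case: ifP => // _.
  by case: xgetP => [x -> [_]|_ //]; exact.
by move/(Order.POrderTheory.le_trans hn); rewrite lee_fin lez_nat ltnn.
Qed.

Lemma lee_sub2 (n : nat) (x : \bar int) :
  (n%:Z%:E <= x - 2%:Z%:E)%E -> (n.+2%:Z%:E <= x)%E.
Proof. by rewrite leeBrDr // -EFinD -PoszD addn2. Qed.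

Lemma lreg0 b x : GRing.lreg b -> b * x = 0 -> x = 0.
Proof. by move=> rb h; apply: rb; rewrite mulr0. Qed.

Lemma tofrac_lreg x (y : totfrac A) :
  (forall z, x * z = 0 -> z = 0) -> frac_map A x * y = 0 -> y = 0.
Proof.
move=> rx; have [a [t [rt ->]]] := tfracP y.
rewrite -[LHS]/(tf_mul (tfrac x 1) (tfrac a t)) tf_mulE //; last exact: lreg1.
rewrite mul1r => /(proj1 (tfrac_eq _ _ rt (@lreg1 _))).
rewrite mulr1 mul0r => /rx ->.
by apply: (proj2 (tfrac_eq _ _ rt (@lreg1 _))); rewrite !mul0r.
Qed.

Lemma tfrac_sub x b x' b' : GRing.lreg b -> GRing.lreg b' ->
  tfrac x b = tfrac x' b' + tfrac 1 (b * b') * frac_map A (b' * x - b * x').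
Proof.
move=> rb rb'; have rbb := lregM rb rb'.
have r1 := @lreg1 A.
rewrite -[RHS]/(tf_add _ (tf_mul _ (tfrac _ 1))) tf_mulE // mulr1 tf_addE //.
by apply: (proj2 (tfrac_eq _ _ _ _)) => //; [exact: lregM | ring].
Qed.

End Depth.

(** * The quotient map *)

Section Quotient.
Variables (R : comNzRingType) (I : idealr R).

Lemma quot_map_eq0 x : (quot_map I x = 0) <-> x \in I.
Proof.
rewrite -[x in x \in I]subr0 Quotient.idealrBE -(rmorph0 (quot_map I)).
by split=> [/eqP|/eqP].
Qed.

Lemma quot_map_surj (y : {ideal_quot I}) : exists x, quot_map I x = y.
Proof. by exists (repr y); exact: reprK. Qed.

End Quotient.

(** * Base change of the exterior algebra and lifting of regular sequences *)

Section BaseChange.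
Variables (R A : comNzRingType) (phi : {rmorphism R -> A}).
Variables (m : nat) (M : freeModule R m).
Implicit Types (u v : ext M).

Lemma coef_bchange u S : coef (ext_bchange phi u) S = phi (coef u S).
Proof. exact: Defs.coefE. Qed.

Lemma ext_bchangeZ a u : ext_bchange phi (a *: u) = phi a *: ext_bchange phi u.
Proof. by apply: extP => S; rewrite coef_extZ !coef_bchange coef_extZ rmorphM. Qed.

Lemma ext_bchangeB u v :
  ext_bchange phi (u - v) = ext_bchange phi u - ext_bchange phi v.
Proof. by apply: extP => S; rewrite coef_extB !coef_bchange coef_extB rmorphB. Qed.

Lemma ext_bchange_wedge u v :
  ext_bchange phi (wedge u v) = wedge (ext_bchange phi u) (ext_bchange phi v).
Proof.
apply: extP => U; rewrite coef_bchange !coef_wedge rmorph_sum.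
by apply: eq_bigr => S _; rewrite !coef_bchange !rmorphM rmorph_sign.
Qed.

Lemma ext_bchange_vec (x : M) :
  ext_bchange phi (ext_vec x) = ext_vec (to_bchange phi x).
Proof.
apply: extP => U; rewrite coef_bchange !coef_ext_sum rmorph_sum.
apply: eq_bigr => i _; rewrite !coef_extZ !coef_emon rmorphM rmorph_nat.
by rewrite /= mxE.
Qed.

Lemma ext_bchange_wedge_all k (omega : 'I_k -> M) :
  ext_bchange phi (wedge_all omega) = wedge_all (fun j => to_bchange phi (omega j)).
Proof.
rewrite !wedge_allE; elim: (enum 'I_k) => [|j s IH].
  rewrite !wedge_seq_nil; apply: extP => U.
  by rewrite coef_bchange !coef_emon rmorph_nat.
by rewrite !wedge_seq_cons ext_bchange_wedge IH ext_bchange_vec.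
Qed.

Lemma ext_bchange_in q u :
  u \in 'Lambda^q(M) -> ext_bchange phi u \in 'Lambda^q(bchange phi M).
Proof.
by move=> /extpowP h; apply/extpowP => S /h e; rewrite coef_bchange e rmorph0.
Qed.

Lemma coef_ideal_lift u y : (forall z, exists x, phi x = z) ->
  coef_ideal (ext_bchange phi u) y -> exists2 x, coef_ideal u x & phi x = y.
Proof.
move=> surj [c ->]; have [d hd] := choice (fun S => surj (c S)).
exists (\sum_S d S * coef u S); first by exists d.
by rewrite rmorph_sum; apply: eq_bigr => S _; rewrite rmorphM hd coef_bchange.
Qed.

(** For surjective [phi], adjoining an element commutes with taking preimages of ideals. A regular
    sequence of the quotient ring thus becomes one of [R] modulo the kernel. *)
Lemma weakly_regular_lift (P : A -> Prop) (s : seq R) :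
  (forall z, exists x, phi x = z) -> weakly_regular P (map phi s) ->
  weakly_regular (fun x => P (phi x)) s.
Proof.
move=> surj; elim: s P => //= a s IH P [ra wa]; split=> [x|].
  by rewrite rmorphM; exact: ra.
have -> : adjoin (fun x => P (phi x)) a = (fun x => adjoin P (phi a) (phi x)).
  apply/funext => x; apply/propext; split=> -[c]; last have [d <-] := surj c.
    by rewrite rmorphB rmorphM; exists (phi c).
  by rewrite -rmorphM -rmorphB; exists d.
exact: IH.
Qed.

End BaseChange.

(** * From the ideal spanned by the [f i] to explicit combinations *)

Section SpanOfGenerators.
Variables (R : comNzRingType) (l : nat) (f : 'I_l -> R).

Lemma ideal_span_ideal : is_ideal (ideal_span f).
Proof.
split; first by exists (fun=> 0); rewrite big1 // => i _; rewrite mul0r.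
  move=> _ _ [c ->] [d ->]; exists (fun i => c i + d i).
  by rewrite -big_split; apply: eq_bigr => i _; rewrite mulrDl.
move=> a _ [c ->]; exists (fun i => a * c i).
by rewrite mulr_sumr; apply: eq_bigr => i _; rewrite mulrA.
Qed.

Variables (m : nat) (M : freeModule R m).
Implicit Types u v : ext M.

Lemma zero_mod_spanP p u : u \in 'Lambda^p(M) -> zero_mod (ideal_span f) u <->
  exists xi : 'I_l -> ext M, (forall i, xi i \in 'Lambda^p(M)) /\
    u = \sum_i f i *: xi i.
Proof.
move=> up; split=> [h|[xi [_ ->]] S]; last first.
  rewrite coef_ext_sum; exists (fun i => coef (xi i) S).
  by apply: eq_bigr => i _; rewrite coef_extZ mulrC.
have [c hc] := choice h.
(* The coefficients chosen for each monomial are assembled into elements, without those outside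
   degree [p]. *)
exists (fun i => homog p (mkext M (fun S => c S i))); split=> [i|]; first exact: homog_in.
apply: extP => S; rewrite coef_ext_sum.
under eq_bigr do rewrite coef_extZ coef_homog Defs.coefE.
case: eqP => [_|/eqP n]; first by rewrite hc; apply: eq_bigr => i _; exact: mulrC.
by rewrite big1 => [|i _]; rewrite ?mulr0 //; apply: (extpowP p u up).
Qed.

Variables (k : nat) (omega : 'I_k -> M).
Local Notation P := (ideal_span f).
Local Notation w := (wedge_seq omega).

Lemma division_zero_mod p r u (gamma : r.-tuple 'I_k -> ext M) :
  division f omega p u gamma ->
  zero_mod P (u - \sum_(J : r.-tuple 'I_k | increasing J) wedge (w J) (gamma J)).
Proof.
case=> _ [xi [hxi ->]]; rewrite addrC addKr.
apply/(@zero_mod_spanP p); last by exists xi.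
by apply: extpow_sum => i _; apply: extpowZ.
Qed.

Lemma division_form_ideal p r u (gamma : r.-tuple 'I_k -> ext M) :
  division f omega p u gamma -> form_ideal omega P (enum 'I_k) r u.
Proof.
move=> /division_zero_mod h; rewrite -[u](subrK (\sum_(J | increasing J) wedge (w J) (gamma J))).
apply: form_idealD; first exact: form_ideal_mod.
apply: (form_ideal_sum ideal_span_ideal) => J _.
by apply: form_ideal_gen => [|i _]; rewrite ?size_tuple ?mem_enum.
Qed.

Lemma form_ideal_division_exists p r u : (r <= p)%N -> u \in 'Lambda^p(M) ->
  form_ideal omega P (enum 'I_k) r u ->
  exists gamma : r.-tuple 'I_k -> ext M, division f omega p u gamma.
Proof.
move=> rp up /(form_idealP ideal_span_ideal)/(_ up)[gamma hin].
move=> /(@zero_mod_spanP p)[|xi [hxi e]].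
  apply: extpowB => //; apply: extpow_sum => J _.
  by have := extpow_wedge (wedge_seq_in omega J) (hin J); rewrite size_tuple subnKC.
exists gamma; split=> [J _|]; first exact: hin.
by exists xi; split; rewrite // -e addrC subrK.
Qed.

Lemma wedge_vanishP p s u : u \in 'Lambda^p(M) ->
  wedge_vanish f omega p s u <-> wedge_zero omega P (enum 'I_k) s u.
Proof.
move=> up.
have win (J : seq 'I_k) : size J = s -> wedge (w J) u \in 'Lambda^(p + s)(M).
  by move=> <-; rewrite addnC extpow_wedge ?wedge_seq_in.
split=> [h J sJ _|h J iJ]; last first.
  apply/zero_mod_spanP; first by rewrite win ?size_tuple.
  by apply: h => [|i _]; rewrite ?size_tuple ?mem_enum.
have [uJ|/wedge_seq_rep->] := boolP (uniq J); last first.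
  by rewrite wedge0l; apply: zero_mod0 ideal_span_ideal.
have [t it /(wedge_seq_perm omega)[e ->]] := exists_increasing uJ sJ.
rewrite wedgeZl; apply: (zero_modZ ideal_span_ideal).
by apply/(@zero_mod_spanP (p + s)%N); [rewrite win ?size_tuple | exact: h].
Qed.

End SpanOfGenerators.

(** * Comparison of quotients over the total ring of fractions *)

Section Fractions.
Variables (A : comNzRingType) (m : nat) (M : freeModule A m) (k : nat).
Variable omega : 'I_k -> M.
Implicit Types u v : ext M.

Local Notation loc := (frac_map A).

Lemma coef_ext_frac u b S : coef (ext_frac u b) S = tfrac (coef u S) b.
Proof. exact: Defs.coefE. Qed.

Lemma ext_frac_sub u v b d : GRing.lreg b -> GRing.lreg d ->
  ext_frac u b = ext_frac v d +
    tfrac 1 (b * d) *: ext_bchange loc (d *: u - b *: v).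
Proof.
move=> rb rd; apply: extP => S; rewrite coef_extD coef_extZ coef_bchange.
by rewrite !coef_ext_frac coef_extB !coef_extZ; exact: tfrac_sub.
Qed.

(** The two sides differ by a multiple of the value of [d *: u - b *: v] at [g]. Each coefficient of
    [Omega] kills this value, hence so does [a], which stays a non-zero-divisor among the
    fractions. *)
Lemma ext_frac_on_kernel q u v a b d
    (g : 'I_q -> {linear bchange loc M -> (totfrac A)^o}) :
  u \in 'Lambda^q(M) -> v \in 'Lambda^q(M) -> GRing.lreg b -> GRing.lreg d ->
  coef_ideal (wedge_all omega) a -> (forall x, a * x = 0 -> x = 0) ->
  wedge (wedge_all omega) (d *: u - b *: v) = 0 ->
  in_kernels (fun j => to_bchange loc (omega j)) g ->
  ext_form (ext_frac u b) g = ext_form (ext_frac v d) g.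
Proof.
move=> hu hv rb rd [e ea] ra h hg; rewrite (ext_frac_sub u v rb rd) ext_formD ext_formZ.
set x := ext_form (ext_bchange _ _) g.
suff -> : x = 0 by rewrite mulr0 addr0.
apply: (tofrac_lreg ra); rewrite ea rmorph_sum mulr_suml big1 // => S _.
rewrite rmorphM -mulrA -coef_bchange ext_bchange_wedge_all ext_form_annihilated ?mulr0 //.
  by apply/ext_bchange_in/extpowB; exact: extpowZ.
rewrite -ext_bchange_wedge_all -ext_bchange_wedge h; apply: extP => S'.
by rewrite coef_bchange !coef_ext0 rmorph0.
Qed.

End Fractions.

(** * The four statements, reduced to divisions modulo the span of the [f i] *)

Theorem theorem3p1
  (R : comNzRingType) (m : nat) (M : freeModule R m)
  (l : nat) (f : 'I_l -> R)
  (I : idealr R) (If : forall x : R, x \in I <-> ideal_span f x)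
  (k : nat) (k_gt0 : (1 <= k)%N) (k_le : (k <= m)%N) (omega : 'I_k -> M)
  (p r s : nat)
  (p_bnd : (1 <= p <= m)%N) (r_bnd : (1 <= r <= m)%N) (s_bnd : (1 <= s <= m)%N)
  (r_le_p : (r <= p)%N) (rs : (r + s = k + 1)%N) :
  let bar := quot_map I in
  let Mbar := bchange bar M in
  let omegabar := fun j => to_bchange bar (omega j) : Mbar in
  let Omega := wedge_all omega in
  let Omegabar := wedge_all omegabar in
  let loc := frac_map {ideal_quot I} in
  let Mfr := bchange loc Mbar in
  let omegafr := fun j => to_bchange loc (omegabar j) : Mfr in
  let dIO := depth (coef_ideal Omegabar) in
  [/\ (* (i) *)
      ((p - r)%N%:Z%:E <= dIO - 2%:Z%:E)%E ->
      forall eta, eta \in 'Lambda^p(M) ->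
        (exists gamma : r.-tuple 'I_k -> ext M, division f omega p eta gamma)
        <-> wedge_vanish f omega p s eta,
      (* (ii) *)
      forall eta, eta \in 'Lambda^p(M) -> wedge_vanish f omega p s eta ->
        exists n : nat, (0 < n)%N /\
          forall a : R, coef_ideal Omega a ->
          exists gamma : r.-tuple 'I_k -> ext M,
            division f omega p (a ^+ n *: eta) gamma,
      forall eta, eta \in 'Lambda^p(M) ->
        forall (b : R) (gamma : r.-tuple 'I_k -> ext M),
          GRing.lreg (bar b) -> division f omega p (b *: eta) gamma ->
          wedge_vanish f omega p s eta,
      (* (iii) *)
      ((p - r)%N%:Z%:E <= dIO - 2%:Z%:E)%E ->
      forall eta, eta \in 'Lambda^p(M) ->
        forall gamma gamma' : r.-tuple 'I_k -> ext M,
          division f omega p eta gamma -> division f omega p eta gamma' ->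
        forall J : r.-tuple 'I_k, increasing J ->
        exists delta : 'I_l -> ext M,
          (forall i, delta i \in 'Lambda^(p - r)(M)) /\
          forall g : 'I_(p - r) -> {linear M -> R^o}, in_kernels omega g ->
            ext_form (gamma J) g =
            ext_form (gamma' J) g + ext_form (\sum_i f i *: delta i) g
    & (* (iv) *)
      (1%:Z%:E <= dIO)%E ->
      forall eta, eta \in 'Lambda^p(M) ->
        forall (b b' : R) (gamma gamma' : r.-tuple 'I_k -> ext M),
          GRing.lreg (bar b) -> GRing.lreg (bar b') ->
          division f omega p (b *: eta) gamma ->
          division f omega p (b' *: eta) gamma' ->
        forall J : r.-tuple 'I_k, increasing J ->
        forall g : 'I_(p - r) -> {linear Mfr -> (totfrac {ideal_quot I})^o},
          in_kernels omegafr g ->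
          ext_form (ext_frac (ext_bchange bar (gamma J)) (bar b)) g =
          ext_form (ext_frac (ext_bchange bar (gamma' J)) (bar b')) g].
Proof.
move=> bar Mbar omegabar Omega Omegabar loc Mfr omegafr dIO.
pose P := ideal_span f.
have iP : is_ideal P := ideal_span_ideal f.
have kerE x : P x <-> bar x = 0 by rewrite quot_map_eq0; symmetry; exact: If.
have surj := @quot_map_surj _ I.
have OmegabarE : Omegabar = ext_bchange bar Omega by rewrite ext_bchange_wedge_all.
have rs' : (r + s = k.+1)%N by rewrite rs addn1.
have regP b : GRing.lreg (bar b) -> forall x, P (b * x) -> P x.
  by move=> rb x /kerE; rewrite rmorphM => /(lreg0 rb) /kerE.
(* A regular sequence of the quotient ring is lifted term by term to coefficients in [R]. *)
have depthP n : (n%:Z%:E <= dIO)%E -> exists2 t : seq R, (n <= size t)%N &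
    {in t, forall a, coef_ideal Omega a} /\ weakly_regular P t.
  move=> /depth_weakly_regular[t nt [tO wt]].
  have [t' [et tO']] : exists t' : seq R,
      map bar t' = t /\ {in t', forall a, coef_ideal Omega a}.
    elim: t {nt wt} tO => [|y t IH] tO; first by exists [::].
    have [|t' [<- h]] := IH; first by move=> z zt; apply: tO; rewrite inE zt orbT.
    have := tO y (mem_head _ _); rewrite OmegabarE => /(coef_ideal_lift surj)[x xO <-].
    by exists (x :: t'); split=> // z; rewrite inE => /orP[/eqP->|/h].
  exists t'; first by rewrite -(size_map bar) et.
  split=> //.
  have -> : P = (fun x => bar x = 0) by apply/funext => x; apply/propext; exact: kerE.
  by apply: (weakly_regular_lift (P := fun x => x = 0)) => //; rewrite et.
have divisible n q r' s' u : (n.+1%:Z%:E <= dIO)%E -> (r' + s' = k.+1)%N ->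
    (q < r' + n)%N -> u \in 'Lambda^q(M) -> wedge_zero omega P (enum 'I_k) s' u ->
    form_ideal omega P (enum 'I_k) r' u.
  by move=> /depthP[t nt [tO wt]] rs'' qr uq; apply: (form_ideal_division iP rs'' qr uq nt tO wt).
(* Cross-multiplying the two divisions gives two expressions of the same multiple of [u];
   [wedge_all_zero_mod] isolates each index [J] of their difference. *)
have annih b b' q u (gamma gamma' : r.-tuple 'I_k -> ext M) :
    division f omega q (b *: u) gamma -> division f omega q (b' *: u) gamma' ->
    forall J, increasing J -> zero_mod P (wedge Omega (b' *: gamma J - b *: gamma' J)).
  move=> /division_zero_mod h /division_zero_mod h'; apply: wedge_all_zero_mod => //.
  under eq_bigr do rewrite wedgeBr !wedgeZr.
  rewrite sumrB -!scaler_sumr.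
  have := zero_modB iP (zero_modZ iP b h') (zero_modZ iP b' h).
  by rewrite !scalerBr !scalerA [b' * b]mulrC opprB addrC addrA subrK.
have converse eta b (gamma : r.-tuple 'I_k -> ext M) : eta \in 'Lambda^p(M) ->
    GRing.lreg (bar b) -> division f omega p (b *: eta) gamma ->
    wedge_vanish f omega p s eta.
  move=> he rb /division_form_ideal hb; apply/wedge_vanishP => // J sJ sub.
  apply: (zero_mod_regular (n := 1) (regP b rb)); rewrite expr1 -wedgeZr.
  by apply: (form_ideal_wedge_zero iP _ hb sJ sub); rewrite addnC rs'.
split.
- move=> hd eta he; split=> [[gamma]|/(wedge_vanishP _ _ _ he) hv].
    (* Form (A) is form (A') with [b = 1]. *)
    rewrite -[eta in division _ _ _ eta]scale1r; apply: converse => //.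
    by rewrite rmorph1; exact: lreg1.
  (* The least [n] with [p < r + n] is [(p - r).+1], and the depth is at least [(p - r).+2]. *)
  apply: form_ideal_division_exists => //; apply: (divisible (p - r).+1 p r s) => //.
    exact: lee_sub2.
  by lia.
- move=> eta he /(wedge_vanishP _ _ _ he) hv; exists (k * #|{set 'I_m}|).+1; split=> // a aO.
  apply: form_ideal_division_exists => //; first exact: extpowZ.
  exact: form_ideal_power hv aO.
- by move=> eta he b gamma; exact: converse.
- move=> hd eta he gamma gamma' d1 d2 J iJ.
  have d_in : gamma J - gamma' J \in 'Lambda^(p - r)(M).
    by case: d1 d2 => h1 _ [h2 _]; apply: extpowB; [exact: h1 | exact: h2].
  (* By [annih] with [b = b' = 1], [Omega] annihilates the difference, which is therefore a
     combination of the [omega j] modulo [P]. *)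
  have h1 : form_ideal omega P (enum 'I_k) 1 (gamma J - gamma' J).
    apply: (divisible (p - r).+1 (p - r)%N 1%N k) => //; first exact: lee_sub2.
    apply: wedge_all_wedge_zero => //.
    have := @annih 1 1 p eta gamma gamma'; rewrite !scale1r => /(_ d1 d2 J iJ).
    by rewrite !scale1r.
  have [v hv vE] := form_ideal_on_kernel (p - r) iP h1.
  (* Only the component of degree [p - r] of [v] matters for its values. *)
  have [delta [hdelta dE]] := (zero_mod_spanP f (homog_in (p - r) v)).1 (zero_mod_homog iP _ hv).
  exists delta; split=> // g hg.
  by rewrite -dE ext_form_homog -(vE g hg) -ext_formD addrC subrK.
move=> h1.
(* The first term of a regular sequence is a non-zero-divisor modulo [P] among the combinations of
   coefficients of [Omega]. *)
have [a aO ra] : exists2 a, coef_ideal Omega a & forall x, P (a * x) -> P x.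
  by have [[|a t] // _ [tO [ra _]]] := depthP 1%N h1; exists a; first exact: tO (mem_head _ _).
move=> eta he b b' gamma gamma' rb rb' d1 d2 J iJ g hg.
have [g1 _] := d1; have [g2 _] := d2.
apply: (ext_frac_on_kernel (a := bar a) _ _ rb rb' _ _ _ hg).
- by apply: ext_bchange_in; exact: g1.
- by apply: ext_bchange_in; exact: g2.
- rewrite -/Omegabar OmegabarE; case: aO => e ->; exists (fun S => bar (e S)).
  by rewrite rmorph_sum; apply: eq_bigr => S _; rewrite rmorphM coef_bchange.
- move=> z; have [x <-] := surj z.
  by rewrite -rmorphM => /kerE /ra /kerE.
have hc := annih _ _ _ _ _ _ d1 d2 J iJ.
rewrite -/Omegabar OmegabarE -!ext_bchangeZ -ext_bchangeB -ext_bchange_wedge.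
by apply: extP => S; rewrite coef_bchange coef_ext0; apply/kerE; exact: hc.
Qed.
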